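(* Let $z_1$ be the solution of the initial value problem $z_1''(t)+\frac{n-1}{2}\bigl(\ln(E G)\bigr)'(t)\,z_1'(t)+(2n-1)z_1(t)=0$, $z_1(0)=1$, $z_1'(0)=0$. Then the first nonzero eigenvalue of $-\Delta$ on the Carlotto–Schulz hypersurface $X$ equals $2n-1$ if and only if $z_1'(T)>0$.
   Context: Fix an integer $n>1$. Let $(r,\theta,\alpha)$ be the Carlotto–Schulz solution on $\mathbb{R}$ of the system $r'=\cos\alpha$, $\theta'=\sin\alpha/\sin r$, $\alpha'=(2n-2)\csc r\,\cos\alpha\,\cot(2\theta)-(2n-1)\cot r\,\sin\alpha$, normalized so that for some $T>0$, $r_0\in(0,\pi/2)$, $\theta_0\in(0,\pi/4)$: $r(0)=\pi/2$, $\alpha(0)=0$, $\theta(0)=\theta_0$, and $\theta(-T/4)=\pi/4$, $r(-T/4)=r_0$, $\alpha(-T/4)=-\pi/2$. Standing facts about this solution: $r,\theta$ are $T$-periodic and $\alpha(t+T)=\alpha(t)+2\pi$; for all $t$: $\theta(-t)=\theta(t)$, $\theta(T/2-t)=\pi/2-\theta(t)$, $r(-t)=\pi-r(t)$, $r(T/2-t)=r(t)$, $\alpha(-t)=-\alpha(t)$, $\alpha(T/2-t)=\pi-\alpha(t)$; $\theta$ is strictly increasing on $[0,T/2]$ with minimum $\theta_0$, $r$ is strictly increasing on $[-T/4,T/4]$ with minimum $r_0$, $\alpha$ is strictly increasing; $0<\theta<\pi/2$ and $0<r<\pi$. The Carlotto–Schulz hypersurface is the minimal embedding $X:\mathbb{S}^{n-1}\times\mathbb{S}^{n-1}\times(\mathbb{R}/T\mathbb{Z})\to\mathbb{S}^{2n}\subset\mathbb{R}^{2n+1}$,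 $X(y,z,t)=(\sin r\cos\theta\,y,\ \sin r\sin\theta\,z,\ \cos r)$, with induced metric $dt^2+E(t)g_{\mathbb{S}^{n-1}}+G(t)g_{\mathbb{S}^{n-1}}$, where $E=\sin^2 r\cos^2\theta$, $G=\sin^2 r\sin^2\theta$; $\Delta$ denotes its Laplace–Beltrami operator. *)

(* Defs.v *)
From HB Require Import structures.
From mathcomp Require Import all_boot all_order all_algebra.
From mathcomp Require Import all_classical all_reals all_analysis.
Import Order.TTheory GRing.Theory Num.Theory.
Import numFieldNormedType.Exports.
Local Open Scope ring_scope.

Set Implicit Arguments.
Unset Strict Implicit.
Unset Printing Implicit Defensive.

Definition pt (R : realType) (n : nat) := ('rV[R]_n * 'rV[R]_n * R)%type.

Fixpoint smoothk (R : realType) (V : normedModType R) (k : nat) (f : V -> R) : Prop :=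
  match k with
  | 0 => continuous f
  | k'.+1 => (forall x, differentiable f x) /\ forall v : V, smoothk k' (fun x => 'D_v f x)
  end.

Definition smooth (R : realType) (V : normedModType R) (f : V -> R) : Prop :=
  forall k, smoothk k f.

Definition Dd (R : realType) (n : nat) (v : pt R n) (F : pt R n -> R) : pt R n -> R :=
  fun p => 'D_v F p.

Definition ey (R : realType) (n : nat) (i : 'I_n) : pt R n := (delta_mx ord0 i, 0, 0).
Definition ez (R : realType) (n : nat) (i : 'I_n) : pt R n := (0, delta_mx ord0 i, 0).
Definition et (R : realType) (n : nat) : pt R n := (0, 0, 1).

Definition sph (R : realType) (n : nat) (y : 'rV[R]_n) : Prop :=
  \sum_(i < n) y ord0 i ^+ 2 = 1.

(* Laplacian of the round unit sphere S^{n-1} acting in the y- (resp. z-)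
   variables, computed from ambient derivatives at points with |y| = 1:
   Delta_S f = Delta_{R^n} f - d^2f/dr^2 - (n-1) df/dr. *)
Definition lapSy (R : realType) (n : nat) (F : pt R n -> R) (p : pt R n) : R :=
  \sum_(i < n) Dd (ey R i) (Dd (ey R i) F) p
  - \sum_(i < n) \sum_(j < n) p.1.1 ord0 i * p.1.1 ord0 j * Dd (ey R j) (Dd (ey R i) F) p
  - (n.-1)%:R * \sum_(i < n) p.1.1 ord0 i * Dd (ey R i) F p.

Definition lapSz (R : realType) (n : nat) (F : pt R n -> R) (p : pt R n) : R :=
  \sum_(i < n) Dd (ez R i) (Dd (ez R i) F) p
  - \sum_(i < n) \sum_(j < n) p.1.2 ord0 i * p.1.2 ord0 j * Dd (ez R j) (Dd (ez R i) F) p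
  - (n.-1)%:R * \sum_(i < n) p.1.2 ord0 i * Dd (ez R i) F p.

Definition Ew (R : realType) (r th : R -> R) (t : R) : R :=
  sin (r t) ^+ 2 * cos (th t) ^+ 2.
Definition Gw (R : realType) (r th : R -> R) (t : R) : R :=
  sin (r t) ^+ 2 * sin (th t) ^+ 2.

Definition coefEG (R : realType) (n : nat) (r th : R -> R) (t : R) : R :=
  ((n.-1)%:R / 2) * derive1 (fun s => ln (Ew r th s * Gw r th s)) t.

(* Laplace-Beltrami operator of the metric dt^2 + E g_S + G g_S on
   S^{n-1} x S^{n-1} x R/TZ, applied to (the restriction of) F. *)
Definition lapX (R : realType) (n : nat) (r th : R -> R) (F : pt R n -> R) (p : pt R n) : R :=
  Dd (et R n) (Dd (et R n) F) p + coefEG n r th p.2 * Dd (et R n) F p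
  + lapSy F p / Ew r th p.2 + lapSz F p / Gw r th p.2.

(* lam is an eigenvalue of -Delta on the Carlotto-Schulz hypersurface:
   there is a smooth function on S^{n-1} x S^{n-1} x (R/TZ) (given as the
   restriction of a smooth ambient function, T-periodic in t on the product
   of spheres), not identically zero, with -Delta u = lam u. *)
Definition is_eigenvalue (R : realType) (n : nat) (T : R) (r th : R -> R) (lam : R) : Prop :=
  exists F : pt R n -> R,
    smooth F /\
    (forall y z t, sph y -> sph z -> F (y, z, t + T) = F (y, z, t)) /\
    (exists y z t, sph y /\ sph z /\ F (y, z, t) != 0) /\
    (forall y z t, sph y -> sph z -> - lapX r th F (y, z, t) = lam * F (y, z, t)).

(* lam is the first nonzero eigenvalue of -Delta (eigenvalues of -Delta are >= 0) *)
Definition first_nonzero_eigenvalue (R : realType) (n : nat) (T : R) (r th : R -> R) (lam : R) : Prop :=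
  0 < lam /\ is_eigenvalue n T r th lam /\
  (forall mu, 0 < mu -> mu < lam -> ~ is_eigenvalue n T r th mu).

(* Main.v *)
(** Both sides of the equivalence hold for every Carlotto-Schulz solution.
    Write [a] for [(n-1)/2 (ln (E G))'].  The profile functions
    [uy = sin r cos th] and [uz = sin r sin th] satisfy
    [u'' + a u' + (2n-1) u = (n-1)/u], so on the half period where [uz < uy] the
    difference [uy - uz] is a positive strict supersolution of the radial
    equation.  By Sturm comparison [z1] is positive on [[0, T/4]], and constancy
    of the Wronskians of [z1] with [cos r], [z1 (T/2 - t)] and [z1 (T - t)] then
    gives [z1' (T) > 0].

    The height [cos r] is an eigenfunction for [2n-1].  If [F] is an
    eigenfunction for [0 < mu < 2n-1] and [sigma] is the reflection of the
    [y]-sphere in a hyperplane orthogonal to [v], the difference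
    [F - F o sigma] vanishes on [<v, y> = 0]; comparing it on [<v, y> >= 0] with a
    perturbation of the supersolution [uy <v, y>] forces it to vanish, so [F]
    does not depend on [y], nor by symmetry on [z].  A radial periodic
    eigenfunction is split by its parities about [0] and [T/4]: the odd part is
    excluded by comparison with [cos r], the even-odd part by comparison with
    [uy - uz], and the even-even part has by Rolle a zero [c] in [(0, T/4)] and
    is excluded by comparison with [cos r] on [[c, T/2 - c]]. *)

Require Import Defs.
From HB Require Import structures.
From mathcomp Require Import all_boot all_order all_algebra.
From mathcomp Require Import all_classical all_reals all_analysis.
From mathcomp Require Import ring lra zify.
Import Order.TTheory GRing.Theory Num.Theory.
Import numFieldNormedType.Exports.
Local Open Scope ring_scope.

Set Implicit Arguments.
Unset Strict Implicit.
Unset Printing Implicit Defensive.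

(** * Derivatives and Sturm comparison *)

Section PointwiseDerivative.
Context {R : realType} {V : normedModType R}.
Implicit Types (f g : V -> R) (x v : V) (k : R).

Lemma is_derive_cstF k x v : is_derive x v (fun=> k) (0 : R).
Proof. exact: is_derive_cst. Qed.

Lemma is_deriveDF f g x v df dg : is_derive x v f df -> is_derive x v g dg ->
  is_derive x v (fun y => f y + g y) (df + dg).
Proof. exact: is_deriveD. Qed.

Lemma is_deriveBF f g x v df dg : is_derive x v f df -> is_derive x v g dg ->
  is_derive x v (fun y => f y - g y) (df - dg).
Proof. exact: is_deriveB. Qed.

Lemma is_deriveNF f x v df : is_derive x v f df ->
  is_derive x v (fun y => - f y) (- df).
Proof. exact: is_deriveN. Qed.

Lemma is_deriveMF f g x v df dg : is_derive x v f df -> is_derive x v g dg ->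
  is_derive x v (fun y => f y * g y) (f x * dg + g x * df).
Proof. exact: is_deriveM. Qed.

Lemma is_deriveXF f n x v df : is_derive x v f df ->
  is_derive x v (fun y => f y ^+ n) (n%:R * f x ^+ n.-1 * df).
Proof.
move=> fdf; have -> : (fun y => f y ^+ n) = f ^+ n.
  by apply/funext => y; rewrite fctE.
exact: is_deriveX.
Qed.

End PointwiseDerivative.

Section RealDerivative.
Context {R : realType}.
Implicit Types (f g : R -> R) (x d : R).

Lemma is_derive_continuous f x d : is_derive x 1 f d -> {for x, continuous f}.
Proof. by case=> fd _; exact/differentiable_continuous/derivable1_diffP. Qed.

Lemma is_derive_compF f g x df dg : is_derive (g x) 1 f df ->
  is_derive x 1 g dg -> is_derive x 1 (fun t => f (g t)) (df * dg).
Proof. exact: is_derive1_comp. Qed.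

Lemma is_derive_sinF f x d : is_derive x 1 f d ->
  is_derive x 1 (fun t => sin (f t)) (cos (f x) * d).
Proof. by move=> fd; apply: (@is_derive_compF sin f). Qed.

Lemma is_derive_cosF f x d : is_derive x 1 f d ->
  is_derive x 1 (fun t => cos (f t)) (- sin (f x) * d).
Proof. by move=> fd; apply: (@is_derive_compF cos f). Qed.

Lemma is_deriveVF f x d : f x != 0 -> is_derive x 1 f d ->
  is_derive x 1 (fun t => (f t)^-1) (- (f x) ^- 2 * d).
Proof. exact: is_deriveV. Qed.

Lemma is_derive_idF x : is_derive x 1 (fun t : R => t) 1.
Proof. exact: is_derive_id. Qed.

Lemma derive_gt0_near f x d : is_derive x 1 f d -> 0 < d ->
  exists2 e, 0 < e & forall t, 0 < `|t - x| < e -> 0 < (f t - f x) / (t - x).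
Proof.
move=> [fx fd] d0.
have fxd : (h^-1 *: (f (h *: 1 + x) - f x) @[h --> 0^'] --> d)%classic.
  by rewrite -fd.
have := @cvgr_gt _ _ _ _ _ _ fxd _ d0.
rewrite near_withinE => -[e /= e0 He]; exists e => // t /andP[tx te].
have := He (t - x); rewrite /= sub0r normrN => /(_ te).
rewrite -normr_gt0 => /(_ tx).
by rewrite /GRing.scale /= mulr1 subrK mulrC.
Qed.

Lemma derive_ge0_right f x d e : is_derive x 1 f d -> 0 < e ->
  (forall t, x < t < x + e -> f x <= f t) -> 0 <= d.
Proof.
move=> fd e0 fle; rewrite leNgt; apply/negP => d0.
have [|e' e'0 H] := derive_gt0_near (is_deriveNF fd).
  by rewrite oppr_gt0.
have {H} := H (x + Num.min e e' / 2).
have m0 : 0 < Num.min e e' by rewrite lt_min e0.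
have me : Num.min e e' <= e by rewrite ge_min lexx.
have me' : Num.min e e' <= e' by rewrite ge_min lexx orbT.
set m := Num.min e e' in m0 me me' *.
rewrite addrAC subrr add0r gtr0_norm; last by lra.
have -> : 0 < m / 2 < e' by lra.
move=> /(_ isT); rewrite pmulr_lgt0; last by rewrite invr_gt0; lra.
have fxm : f x <= f (x + m / 2) by apply: fle; lra.
lra.
Qed.

End RealDerivative.

Section SturmComparison.
Local Open Scope classical_set_scope.
Local Open Scope ring_scope.
Context {R : realType}.
Implicit Types (f g h df ddf dh ddh a : R -> R) (s t x mu : R).

Lemma mean_value f df (s t : R) : (forall x, is_derive x 1 f (df x)) -> s < t ->
  exists2 c, s < c < t & f t - f s = df c * (t - s).
Proof.
move=> fd st.
have fc : {within `[s, t], continuous f}.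
  by apply: continuous_subspaceT => x; exact: is_derive_continuous (fd x).
have [c] := MVT st (fun x _ => fd x) fc.
by rewrite in_itv /= => sct fE; exists c.
Qed.

(** The zero is the supremum of the points of []-oo, t]] where [f <= 0]. A positive value there
    would contradict adherence, and a negative one would persist just to the right. *)
Lemma zero_before f s t : continuous f -> f s <= 0 -> s <= t -> 0 < f t ->
  exists u, [/\ s <= u < t, f u = 0 & forall x, u < x <= t -> 0 < f x].
Proof.
move=> fc fs st ft.
pose A := [set x | (x <= t) && (f x <= 0)]%classic.
have As : A s by rewrite /A /= st.
have hA : has_sup A by split; [exists s | exists t => x /andP[]].
have [u [Au Aadh ut]] : exists u, [/\ forall x, A x -> x <= u,
    forall e, 0 < e -> exists2 x, A x & u - e < x & u <= t].
  exists (sup A); split; [exact: sup_upper_bound|move=> e e0; exact: sup_adherent|].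
  by apply: ge_sup => [|x /andP[]]; first by exists s.
have su := Au _ As.
have fpos x : u < x <= t -> 0 < f x.
  move=> /andP[ux xt]; rewrite ltNge; apply/negP => fx.
  have : x <= u by apply: Au; rewrite /A /= xt.
  by rewrite leNgt ux.
have fu_le : f u <= 0.
  rewrite leNgt; apply/negP => fu.
  have := @cvgr_gt _ _ _ _ _ _ (fc u) _ fu.
  move=> -[e /= e0 He].
  have [x Ax ux] := Aadh _ e0.
  have xu := Au _ Ax.
  case/andP: Ax => _; rewrite leNgt; apply/negP/negPn.
  by apply: He; rewrite /ball /= ger0_norm ?subr_ge0//; lra.
have ut' : u < t.
  by rewrite lt_neqAle ut andbT; apply: contraTneq ft => <-; rewrite -leNgt.
exists u; split=> //; first by rewrite su.
apply/eqP; rewrite eq_le fu_le /= leNgt; apply/negP => fu.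
have := @cvgr_lt _ _ _ _ _ _ (fc u) _ fu.
move=> -[e /= e0 He].
have m0 : 0 < Num.min e (t - u) by rewrite lt_min e0 subr_gt0.
have me : Num.min e (t - u) <= e by rewrite ge_min lexx.
have mt : Num.min e (t - u) <= t - u by rewrite ge_min lexx orbT.
have /He : ball u e (u + Num.min e (t - u) / 2).
  by rewrite /ball /= opprD addrA subrr add0r normrN gtr0_norm; lra.
have /fpos : u < u + Num.min e (t - u) / 2 <= t by lra.
by lra.
Qed.

Lemma zero_after f s t : continuous f -> f t <= 0 -> s <= t -> 0 < f s ->
  exists u, [/\ s < u <= t, f u = 0 & forall x, s <= x < u -> 0 < f x].
Proof.
move=> fc ft st fs.
have [||||u [su fu fp]] := @zero_before (fun x => f (- x)) (- t) (- s).
- by move=> x; apply: continuous_comp; [exact: opp_continuous|exact: fc].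
- by rewrite opprK.
- by rewrite lerN2.
- by rewrite opprK.
exists (- u); split=> //; first by lra.
by move=> x xu; rewrite -[x]opprK; apply: fp; lra.
Qed.

Section Equation.
Variables (a p : R -> R).
Hypotheses (p_gt0 : forall t, 0 < p t)
  (p_derive : forall t, is_derive t 1 p (a t * p t)).

(** The weight [p] is an integrating factor: [p' = a p] absorbs the first-order terms, and the
    products of first derivatives cancel. *)
Lemma is_derive_wronskian f df ddf h dh ddh t :
  is_derive t 1 f (df t) -> is_derive t 1 df (ddf t) ->
  is_derive t 1 h (dh t) -> is_derive t 1 dh (ddh t) ->
  is_derive t 1 (fun x => p x * (df x * h x - f x * dh x))
    (p t * ((ddf t + a t * df t) * h t - f t * (ddh t + a t * dh t))).
Proof.
move=> fd fd' hd hd'; apply: is_derive_eq.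
by rewrite /GRing.scale /=; ring.
Qed.

(** If [f] is positive somewhere, let []u0, u1[] be the nodal interval around that point. There the
    weighted Wronskian of [f] with the strict supersolution [h] is increasing, while [df u0 >= 0],
    [df u1 <= 0] and [h >= 0] make it nonnegative at [u0] and nonpositive at [u1]. Nothing is
    divided by [h], so [h] may vanish at the endpoints. *)
Lemma sturm_dirichlet_le0 mu f df ddf h dh ddh s t :
  (forall x, is_derive x 1 f (df x)) -> (forall x, is_derive x 1 df (ddf x)) ->
  (forall x, is_derive x 1 h (dh x)) -> (forall x, is_derive x 1 dh (ddh x)) ->
  (forall x, ddf x + a x * df x + mu * f x = 0) ->
  (forall x, s <= x <= t -> 0 <= h x) ->
  (forall x, s < x < t -> ddh x + a x * dh x + mu * h x < 0) ->
  f s = 0 -> f t = 0 -> forall x, s <= x <= t -> f x <= 0.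
Proof.
move=> fd fd' hd hd' fE h0 hE fs ft x sxt; rewrite leNgt; apply/negP => fx.
have fc : continuous f by move=> y; exact: is_derive_continuous (fd y).
have [sx xt] := andP sxt.
have [|u0 [u0x fu0 fpos0]] := zero_before fc _ sx fx; first by rewrite fs.
have [|u1 [u1x fu1 fpos1]] := zero_after fc _ xt fx; first by rewrite ft.
have fpos y : u0 < y < u1 -> 0 < f y.
  move=> yu; have [yx|xy] := leP y x; first by apply: fpos0; lra.
  by apply: fpos1; lra.
have df0 : 0 <= df u0.
  apply: (derive_ge0_right (e := u1 - u0) (fd u0)) => [|y yu]; first by lra.
  by rewrite fu0; apply/ltW/fpos; lra.
have df1 : df u1 <= 0.
  have fd1 (y : R) : is_derive y 1 (fun z => f (- z)) (- df (- y)).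
    rewrite -mulrN1; exact: (is_derive_compF (f := f)).
  rewrite -oppr_ge0 -[u1]opprK.
  apply: (derive_ge0_right (e := u1 - u0) (fd1 (- u1))) => [|y yu]; first by lra.
  by rewrite opprK fu1; apply/ltW/fpos; lra.
have u01 : u0 < u1 by lra.
pose W y := p y * (df y * h y - f y * dh y).
have [c cu WE] := mean_value (fun y => is_derive_wronskian (fd y) (fd' y) (hd y) (hd' y)) u01.
have : 0 < W u1 - W u0.
  rewrite /W WE; apply: mulr_gt0; last by lra.
  apply: mulr_gt0 => //.
  have -> : (ddf c + a c * df c) * h c - f c * (ddh c + a c * dh c) =
    - (f c * (ddh c + a c * dh c + mu * h c)).
    have -> : ddf c + a c * df c = - (mu * f c) by have := fE c; lra.
    by ring.
  rewrite oppr_gt0 pmulr_rlt0; last by apply: fpos.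
  by apply: hE; lra.
rewrite /W fu0 fu1 !mul0r !subr0 subr_gt0.
have : p u1 * (df u1 * h u1) <= 0.
  rewrite pmulr_rle0//; apply: mulr_le0_ge0 => //; apply: h0; lra.
have : 0 <= p u0 * (df u0 * h u0).
  rewrite pmulr_rge0//; apply: mulr_ge0 => //; apply: h0; lra.
by lra.
Qed.

Lemma sturm_dirichlet mu f df ddf h dh ddh s t :
  (forall x, is_derive x 1 f (df x)) -> (forall x, is_derive x 1 df (ddf x)) ->
  (forall x, is_derive x 1 h (dh x)) -> (forall x, is_derive x 1 dh (ddh x)) ->
  (forall x, ddf x + a x * df x + mu * f x = 0) ->
  (forall x, s <= x <= t -> 0 <= h x) ->
  (forall x, s < x < t -> ddh x + a x * dh x + mu * h x < 0) ->
  f s = 0 -> f t = 0 -> forall x, s <= x <= t -> f x = 0.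
Proof.
move=> fd fd' hd hd' fE h0 hE fs ft x sxt; apply/eqP; rewrite eq_le.
rewrite (sturm_dirichlet_le0 fd fd' hd hd' fE h0 hE fs ft sxt) /= -oppr_le0.
apply: (sturm_dirichlet_le0 (f := fun y => - f y) (df := fun y => - df y)
  (ddf := fun y => - ddf y) (mu := mu) _ _ hd hd' _ h0 hE _ _ sxt).
- by move=> y; have := fE y; lra.
- by rewrite fs oppr0.
- by rewrite ft oppr0.
Qed.

Lemma wronskian_cst mu f df ddf h dh ddh s t :
  (forall x, is_derive x 1 f (df x)) -> (forall x, is_derive x 1 df (ddf x)) ->
  (forall x, is_derive x 1 h (dh x)) -> (forall x, is_derive x 1 dh (ddh x)) ->
  (forall x, ddf x + a x * df x + mu * f x = 0) ->
  (forall x, ddh x + a x * dh x + mu * h x = 0) ->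
  p s * (df s * h s - f s * dh s) = p t * (df t * h t - f t * dh t).
Proof.
move=> fd fd' hd hd' fE hE.
apply: (is_derive_0_is_cst (f := fun x => p x * (df x * h x - f x * dh x))) => x.
refine (is_derive_eq (is_derive_wronskian (fd x) (fd' x) (hd x) (hd' x)) _).
have -> : ddf x + a x * df x = - (mu * f x) by have := fE x; lra.
have -> : ddh x + a x * dh x = - (mu * h x) by have := hE x; lra.
by ring.
Qed.

End Equation.

(* Gronwall for the energy [f^2 + f'^2]: multiplied by [exp (-+ C t)] it is
   monotone on an interval where [C] dominates the coefficients. *)
Lemma linear_ode_unique a mu f df ddf t0 : continuous a ->
  (forall x, is_derive x 1 f (df x)) -> (forall x, is_derive x 1 df (ddf x)) ->
  (forall x, ddf x + a x * df x + mu * f x = 0) ->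
  f t0 = 0 -> df t0 = 0 -> forall t, f t = 0.
Proof.
move=> ac fd fd' fE f0 df0 t.
have [M aM] : exists M, forall x, Num.min t t0 <= x <= Num.max t t0 -> `|a x| <= M.
  have mM : Num.min t t0 <= Num.max t t0 by rewrite ge_min !le_max lexx.
  have [|c _ cM] := @EVT_max R (fun x => `|a x|) _ _ mM.
    apply: continuous_subspaceT => x; apply: continuous_comp; first exact: ac.
    exact: norm_continuous.
  by exists `|a c| => x xt; apply: cM; rewrite in_itv.
(* Once the equation eliminates [ddf], the derivative of the energy is
   [(1 - mu) (2 f f') - 2 a f'^2], and [2 |f f'| <= f^2 + f'^2]. *)
pose C := 1 + `|mu| + 2 * M.
have bound x : Num.min t t0 <= x <= Num.max t t0 ->
    `|2 * f x * df x + 2 * df x * ddf x| <= C * (f x ^+ 2 + df x ^+ 2).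
  move=> /aM; have -> : ddf x = - (a x * df x) - mu * f x by have := fE x; lra.
  move=> axM; have -> : 2 * f x * df x + 2 * df x * (- (a x * df x) - mu * f x) =
    (1 - mu) * (2 * f x * df x) - 2 * a x * df x ^+ 2 by ring.
  have Q0 : `|2 * f x * df x| <= f x ^+ 2 + df x ^+ 2.
    rewrite ler_norml; have := sqr_ge0 (f x + df x); have := sqr_ge0 (f x - df x).
    by move=> ? ?; apply/andP; split; lra.
  have mu1 : `|1 - mu| <= 1 + `|mu| by apply: le_trans (ler_normB _ _) _; rewrite normr1.
  apply: le_trans (ler_normB _ _) _.
  rewrite [`|(1 - mu) * _|]normrM [`|2 * a x * _|]normrM [`|2 * a x|]normrM.
  rewrite (ger0_norm (sqr_ge0 _)) (ger0_norm (ler0n _ 2)) /C [leRHS]mulrDl.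
  apply: lerD; first by apply: ler_pM.
  apply: ler_pM; [by apply: mulr_ge0|exact: sqr_ge0|by rewrite ler_pM2l|].
  by rewrite lerDr sqr_ge0.
have expd (k x : R) : is_derive x 1 (fun y => expR (k * y)) (expR (k * x) * k).
  apply: (is_derive_compF (f := @expR R)).
  by apply: is_derive_eq; rewrite /GRing.scale /= mulr1.
pose En k x := expR (k * x) * (f x ^+ 2 + df x ^+ 2).
have End k x : is_derive x 1 (En k) (expR (k * x) *
    (k * (f x ^+ 2 + df x ^+ 2) + (2 * f x * df x + 2 * df x * ddf x))).
  by apply: is_derive_eq; rewrite /GRing.scale /=; ring.
have E0 k : En k t0 = 0 by rewrite /En f0 df0; ring.
have Et k : En k t <= 0 -> f t = 0.
  rewrite /En pmulr_rle0 ?expR_gt0// => le0; apply/eqP; rewrite -sqrf_eq0.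
  by have := sqr_ge0 (f t); have := sqr_ge0 (df t); lra.
have [tt0|t0t|->//] := ltgtP t t0.
- apply: (Et C); have [c ct CE] := mean_value (End C) tt0.
  have : 0 <= En C t0 - En C t.
    rewrite CE; apply: mulr_ge0; last by lra.
    apply: mulr_ge0; first exact: expR_ge0.
    have := bound c; rewrite (min_idPl (ltW tt0)) (max_idPr (ltW tt0)).
    rewrite (_ : _ <= _ <= _) => [/(_ isT)|]; last by lra.
    by rewrite ler_norml; lra.
  by rewrite E0; lra.
- apply: (Et (- C)); have [c ct CE] := mean_value (End (- C)) t0t.
  have : En (- C) t - En (- C) t0 <= 0.
    rewrite CE; apply: mulr_le0_ge0; last by lra.
    apply: mulr_ge0_le0; first exact: expR_ge0.
    have := bound c; rewrite (min_idPr (ltW t0t)) (max_idPl (ltW t0t)).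
    rewrite (_ : _ <= _ <= _) => [/(_ isT)|]; last by lra.
    by rewrite ler_norml; lra.
  by rewrite E0; lra.
Qed.

End SturmComparison.

(** * Second derivatives along arcs *)

Section Curves.
Local Open Scope classical_set_scope.
Local Open Scope ring_scope.
Context {R : realType} {V : normedModType R}.
Implicit Types (F G : V -> R) (p v w B C : V).

(** What the second derivative test uses of smoothness. Two derivatives suffice to check it for
    separable barriers, and it is stable under differences, scaling and continuous linear
    substitutions. *)
Definition twice_differentiable F :=
  (forall x, differentiable F x) /\
  forall v x, differentiable (fun y => 'D_v F y) x.

Lemma smooth_twice_differentiable F : smooth F -> twice_differentiable F.
Proof.
move=> /(_ 2) [Fd /= Fd2]; split=> // v x.
by have [] := Fd2 v.
Qed.

Lemma derive_dirD F x v w : differentiable F x ->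
  'D_(v + w) F x = 'D_v F x + 'D_w F x.
Proof. by move=> Fx; rewrite !deriveE// linearD. Qed.

Lemma derive_dirZ F x k v : differentiable F x -> 'D_(k *: v) F x = k * 'D_v F x.
Proof. by move=> Fx; rewrite !deriveE// linearZ. Qed.

Lemma derive_dirB F x v w : differentiable F x ->
  'D_(v - w) F x = 'D_v F x - 'D_w F x.
Proof. by move=> Fx; rewrite !deriveE// linearB. Qed.

Lemma derive_dir_sum F x n (k : 'I_n -> R) (v : 'I_n -> V) : differentiable F x ->
  'D_(\sum_i k i *: v i) F x = \sum_i k i * 'D_(v i) F x.
Proof.
move=> Fx; rewrite deriveE// linear_sum; apply: eq_bigr => i _.
by rewrite linearZ/= deriveE.
Qed.

Lemma is_derive_scalel (k : R -> R) (t dk : R) v : is_derive t 1 k dk ->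
  is_derive t 1 (fun s => k s *: v) (dk *: v).
Proof.
case=> kd kE.
have lim : (fun h : R => h^-1 *: (((fun s => k s *: v) \o shift t) (h *: 1) - k t *: v))
    @ 0^' --> dk *: v.
  have -> : (fun h : R => h^-1 *: (((fun s => k s *: v) \o shift t) (h *: 1) - k t *: v)) =
    (fun h : R => (h^-1 *: ((k \o shift t) (h *: 1) - k t)) *: v).
    by apply/funext => h /=; rewrite -scalerBl scalerA.
  by apply: cvgZr_tmp; rewrite -kE; exact: kd.
by apply: DeriveDef; [apply/cvg_ex; exists (dk *: v)|exact/cvg_lim].
Qed.

Lemma is_derive_curve F (g : R -> V) (t : R) dg : differentiable F (g t) ->
  is_derive t 1 g dg -> is_derive t 1 (fun s => F (g s)) ('D_dg F (g t)).
Proof.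
move=> Fd [gd gE].
have gdiff : differentiable g t by exact/derivable1_diffP.
have Fgd : differentiable (F \o g) t by exact: differentiable_comp.
apply: DeriveDef; first exact: diff_derivable.
rewrite (deriveE (f := F \o g))// diff_comp//= -(deriveE (f := g))// gE.
by rewrite deriveE.
Qed.

(** An arc through [p] at [s = 0] with velocity [C] and acceleration [- B]. It is the orbit of [p]
    under a plane rotation when [B] is the projection of [p] on the plane and [C] its quarter turn;
    for [B = 0] it runs along a segment. *)
Definition circle_arc p B C (s : R) : V := p + (cos s - 1) *: B + sin s *: C.

Lemma arc0 p B C : circle_arc p B C 0 = p.
Proof. by rewrite /circle_arc cos0 sin0 subrr !scale0r !addr0. Qed.

Lemma is_derive_arc p B C (s : R) : is_derive s 1 (circle_arc p B C) (- sin s *: B + cos s *: C).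
Proof.
have cd : is_derive s 1 (fun x : R => cos x - 1) (- sin s).
  by apply: is_derive_eq; rewrite subr0.
have sd := is_derive_scalel C (is_derive_sin s).
have := is_derive_scalel B cd => {}cd.
by apply: is_derive_eq; rewrite add0r.
Qed.

Section Second.
Variables (F : V -> R) (p B C : V).
Hypothesis F2 : twice_differentiable F.

Lemma is_derive_along_arc (s : R) : is_derive s 1 (fun x => F (circle_arc p B C x))
  (- sin s * 'D_B F (circle_arc p B C s) + cos s * 'D_C F (circle_arc p B C s)).
Proof.
have [Fd _] := F2.
have := is_derive_curve (Fd _) (is_derive_arc p B C s).
by rewrite derive_dirD// !derive_dirZ.
Qed.

Lemma is_derive2_along_arc : is_derive (0 : R) 1
  (fun s => - sin s * 'D_B F (circle_arc p B C s) + cos s * 'D_C F (circle_arc p B C s))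
  ('D_C (fun x => 'D_C F x) p - 'D_B F p).
Proof.
have [_ Fd2] := F2.
have dB := is_derive_curve (Fd2 B _) (is_derive_arc p B C 0).
have dC := is_derive_curve (Fd2 C _) (is_derive_arc p B C 0).
have dsin : is_derive (0 : R) 1 (fun s : R => - sin s) (- 1).
  by apply: is_derive_eq; rewrite cos0.
have dcos : is_derive (0 : R) 1 (fun s : R => cos s) 0.
  by apply: is_derive_eq; rewrite sin0 oppr0.
refine (is_derive_eq (is_deriveDF (is_deriveMF dsin dB) (is_deriveMF dcos dC)) _).
rewrite arc0 sin0 cos0 oppr0 scale0r scale1r add0r.
by rewrite mul0r add0r mul1r mulr0 addr0 mulrN1 addrC.
Qed.

End Second.

(** Only differentiability of [df] at [0] is assumed, so no Taylor expansion is used: if [d > 0]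
    then [df > 0] just to the right of [0], and the mean value theorem contradicts the maximum. *)
Lemma local_max_derive2 (f df : R -> R) d e : 0 < e ->
  (forall t : R, is_derive t 1 f (df t)) -> is_derive (0 : R) 1 df d ->
  (forall t, `|t| < e -> f t <= f 0) -> df 0 = 0 /\ d <= 0.
Proof.
move=> e0 fd dfd fmax.
have df0 : df 0 = 0.
  apply/eqP; rewrite eq_le -oppr_ge0; apply/andP; split.
    apply: (derive_ge0_right (is_deriveNF (fd 0)) e0) => t te.
    by rewrite lerN2; apply: fmax; rewrite gtr0_norm; lra.
  have fd1 : is_derive (0 : R) 1 (fun t => - f (- t)) (df 0).
    have fd' : is_derive (- 0 : R) 1 f (df 0) by rewrite oppr0.
    refine (is_derive_eq (is_deriveNF (is_derive_compF fd' (is_deriveNF (is_derive_idF 0)))) _).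
    by rewrite mulrN1 opprK.
  apply: (derive_ge0_right fd1 e0) => t te.
  by rewrite lerN2 oppr0; apply: fmax; rewrite normrN gtr0_norm; lra.
split=> //; rewrite leNgt; apply/negP => d0.
have [e' e'0 H] := derive_gt0_near dfd d0.
have m0 : 0 < Num.min e e' by rewrite lt_min e0.
have me : Num.min e e' <= e by rewrite ge_min lexx.
have me' : Num.min e e' <= e' by rewrite ge_min lexx orbT.
set m := Num.min e e' in m0 me me'.
have m20 : 0 < m / 2 by lra.
have [c cm fE] := mean_value fd m20.
have : f (m / 2) <= f 0 by apply: fmax; rewrite gtr0_norm; lra.
have : 0 < (df c - df 0) / (c - 0) by apply: H; rewrite subr0 gtr0_norm; lra.
rewrite df0 !subr0 pmulr_lgt0; last by rewrite invr_gt0; lra.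
by move=> dfc; rewrite -subr_le0 fE subr0 leNgt mulr_gt0.
Qed.

Lemma arc_max F p B C e : twice_differentiable F -> 0 < e ->
  (forall s, `|s| < e -> F (circle_arc p B C s) <= F p) ->
  'D_C F p = 0 /\ 'D_C (fun x => 'D_C F x) p - 'D_B F p <= 0.
Proof.
move=> F2 e0 Fmax.
have := local_max_derive2 e0 (is_derive_along_arc p B C F2) (is_derive2_along_arc p B C F2).
rewrite arc0 sin0 cos0 oppr0 mul0r add0r mul1r; apply => t te.
by apply: Fmax.
Qed.

Lemma arc_cst F p B C : twice_differentiable F ->
  (forall s, F (circle_arc p B C s) = F p) ->
  'D_C (fun x => 'D_C F x) p - 'D_B F p = 0.
Proof.
move=> F2 Fcst; apply/eqP; rewrite eq_le.
have Fle (s : R) : `|s| < 1 -> F (circle_arc p B C s) <= F p by rewrite Fcst.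
have [_ ->] := arc_max F2 ltr01 Fle.
have := local_max_derive2 ltr01 (fun t => is_deriveNF (is_derive_along_arc p B C F2 t))
   (is_deriveNF (is_derive2_along_arc p B C F2)).
case=> [t _|_]; first by rewrite !Fcst.
by rewrite oppr_le0 => ->.
Qed.

Lemma twice_differentiableB F G : twice_differentiable F -> twice_differentiable G ->
  twice_differentiable (fun x => F x - G x).
Proof.
move=> [Fd Fd2] [Gd Gd2]; split=> [x|v x]; first exact: differentiableB.
have -> : (fun y => 'D_v (fun x => F x - G x) y) = (fun y => 'D_v F y - 'D_v G y).
  by apply/funext => y; rewrite deriveB//; exact: diff_derivable.
exact: differentiableB.
Qed.

Lemma twice_differentiableZ k F : twice_differentiable F ->
  twice_differentiable (fun x => k * F x).
Proof.
move=> [Fd Fd2]; split=> [x|v x]; first exact: differentiableZ.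
have -> : (fun y => 'D_v (fun x => k * F x) y) = (fun y => k * 'D_v F y).
  by apply/funext => y; rewrite (@deriveZ _ _ _ F)//; exact: diff_derivable.
exact: differentiableZ.
Qed.

Lemma derive2B F G v w p : twice_differentiable F -> twice_differentiable G ->
  'D_w (fun y => 'D_v (fun x => F x - G x) y) p =
  'D_w (fun y => 'D_v F y) p - 'D_w (fun y => 'D_v G y) p.
Proof.
move=> [Fd Fd2] [Gd Gd2].
have -> : (fun y => 'D_v (fun x => F x - G x) y) = (fun y => 'D_v F y - 'D_v G y).
  by apply/funext => y; rewrite deriveB//; exact: diff_derivable.
by rewrite deriveB//; exact: diff_derivable.
Qed.

Lemma derive2Z k F v w p : twice_differentiable F ->
  'D_w (fun y => 'D_v (fun x => k * F x) y) p = k * 'D_w (fun y => 'D_v F y) p.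
Proof.
move=> [Fd Fd2].
have -> : (fun y => 'D_v (fun x => k * F x) y) = (fun y => k * 'D_v F y).
  by apply/funext => y; rewrite (@deriveZ _ _ _ F)//; exact: diff_derivable.
by rewrite (@deriveZ _ _ _ (fun y => 'D_v F y))//; exact: diff_derivable.
Qed.

Lemma derive2_dirE F (v1 v2 : V) p (k1 k2 : R) : twice_differentiable F ->
  let D (u w : V) := 'D_w (fun x => 'D_u F x) p in
  D (k1 *: v1 - k2 *: v2) (k1 *: v1 - k2 *: v2) =
  k1 ^+ 2 * D v1 v1 - k1 * k2 * D v2 v1 - k2 * k1 * D v1 v2 + k2 ^+ 2 * D v2 v2.
Proof.
move=> [Fd Fd2] D.
have Dl w : D (k1 *: v1 - k2 *: v2) w = k1 * D v1 w - k2 * D v2 w.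
  rewrite /D.
  have -> : (fun x => 'D_(k1 *: v1 - k2 *: v2) F x) =
            (fun x => k1 * 'D_v1 F x - k2 * 'D_v2 F x).
    by apply/funext => x; rewrite derive_dirB// !derive_dirZ.
  have dz k u : derivable (fun x => k * 'D_u F x) p w.
    by apply: diff_derivable; exact: differentiableZ.
  have dZ k u : 'D_w (fun x => k * 'D_u F x) p = k * 'D_w (fun x => 'D_u F x) p.
    by apply: (@deriveZ _ _ _ (fun x => 'D_u F x)); exact: diff_derivable.
  by rewrite deriveB// !dZ.
have Dr u : D u (k1 *: v1 - k2 *: v2) = k1 * D u v1 - k2 * D u v2.
  by rewrite /D derive_dirB// !derive_dirZ.
rewrite Dl !Dr; move: (D v1 v1) (D v1 v2) (D v2 v1) (D v2 v2) => d11 d12 d21 d22.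
by ring.
Qed.

Lemma derive2_dir_suml F m (k : 'I_m -> R) (v : 'I_m -> V) w p : twice_differentiable F ->
  'D_w (fun x => 'D_(\sum_i k i *: v i) F x) p =
  \sum_i k i * 'D_w (fun x => 'D_(v i) F x) p.
Proof.
move=> [Fd Fd2].
have -> : (fun x => 'D_(\sum_i k i *: v i) F x) = \sum_i (fun x => k i * 'D_(v i) F x).
  by apply/funext => x; rewrite derive_dir_sum// fct_sumE.
rewrite derive_sum; last first.
  by move=> i; apply: diff_derivable; exact: differentiableZ.
apply: eq_bigr => i _.
by rewrite (@deriveZ _ _ _ (fun x => 'D_(v i) F x)); last exact: diff_derivable.
Qed.

Lemma derive_comp_linear (L : {linear V -> V}) F v p :
  'D_v (fun x => F (L x)) p = 'D_(L v) F (L p).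
Proof.
rewrite /derive.
have -> : (fun h : R => h^-1 *: (((fun x => F (L x)) \o shift p) (h *: v) - F (L p))) =
          (fun h : R => h^-1 *: ((F \o shift (L p)) (h *: L v) - F (L p))) => //.
by apply/funext => h /=; rewrite linearP.
Qed.

Lemma twice_differentiable_comp (L : {linear V -> V}) F : continuous L ->
  twice_differentiable F -> twice_differentiable (fun x => F (L x)).
Proof.
move=> Lc [Fd Fd2]; split=> [x|v x].
  apply: (differentiable_comp (f := L) (g := F)) => //.
  exact: linear_differentiable.
have -> : (fun y => 'D_v (fun x => F (L x)) y) = (fun y => 'D_(L v) F (L y)).
  by apply/funext => y; rewrite derive_comp_linear.
apply: (differentiable_comp (f := L) (g := fun y => 'D_(L v) F y)) => //.
exact: linear_differentiable.
Qed.

End Curves.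

(** * The spherical Laplacian and the maximum principle *)

Section SphereLaplacian.
Local Open Scope classical_set_scope.
Local Open Scope ring_scope.
Context {R : realType} {n : nat}.
Notation pt := (pt R n).
Implicit Types (F G : pt -> R) (p q : pt) (y v : 'rV[R]_n).

Definition dot y v : R := \sum_i y ord0 i * v ord0 i.

Definition rot_velocity p i j : pt :=
  p.1.1 ord0 i *: ey R j - p.1.1 ord0 j *: ey R i.

(** For [i != j], minus the initial acceleration of the rotation of [p] in the [(i, j)] plane, that
    is, the projection of the [y]-component on that plane. *)
Definition rot_accel p i j : pt :=
  p.1.1 ord0 i *: ey R i + p.1.1 ord0 j *: ey R j.

(** The algebra of [lapSy_rot], with [d] and [b] in place of the first and second derivatives. The
    factor 2 arises because each plane occurs as [(i, j)] and as [(j, i)]; the diagonal terms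
    removed from the full double sum are [- 2 y_i d_i], which turns [n] into [n - 1]. *)
Lemma rot_sum (y d : 'I_n -> R) (b : 'I_n -> 'I_n -> R) : \sum_i y i ^+ 2 = 1 ->
  \sum_i \sum_(j | j != i)
    (y i ^+ 2 * b j j - y i * y j * b i j - y j * y i * b j i + y j ^+ 2 * b i i
     - (y i * d i + y j * d j)) =
  2 * (\sum_i b i i - \sum_i \sum_j y i * y j * b i j
       - n.-1%:R * \sum_i y i * d i).
Proof.
move=> y1.
(* The predecessor is truncated at 0; a unit vector exists only for [n > 0]. *)
have n0 : n%:R = n.-1%:R + 1 :> R.
  case: n y d b y1 => [|m] y d b /=; last by rewrite -natr1.
  by rewrite big_ord0 => /esym/eqP; rewrite oner_eq0.
pose G i j := y i ^+ 2 * b j j - y i * y j * b i j - y j * y i * b j i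
  + y j ^+ 2 * b i i - (y i * d i + y j * d j).
have -> : \sum_i \sum_(j | j != i) G i j = \sum_i \sum_j G i j - \sum_i G i i.
  by rewrite -sumrB; apply: eq_bigr => i _; rewrite [in RHS](bigD1 i)//= addrAC subrr add0r.
have -> : \sum_i G i i = - 2 * \sum_i y i * d i.
  by rewrite mulr_sumr; apply: eq_bigr => i _; rewrite /G; ring.
rewrite /G; under eq_bigr do rewrite !(big_split, sumrN)/=.
rewrite !(big_split, sumrN)/=.
have -> : \sum_i \sum_j y i ^+ 2 * b j j = \sum_i b i i.
  by under eq_bigr do rewrite -mulr_sumr; rewrite -mulr_suml y1 mul1r.
have -> : \sum_i \sum_j y j ^+ 2 * b i i = \sum_i b i i.
  by under eq_bigr do rewrite -mulr_suml y1 mul1r.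
have -> : \sum_i \sum_j y j * y i * b j i = \sum_i \sum_j y i * y j * b i j.
  by rewrite exchange_big.
have -> : \sum_i \sum_(j < n) y i * d i = n%:R * \sum_i y i * d i.
  by rewrite mulr_sumr; apply: eq_bigr => i _; rewrite sumr_const card_ord mulr_natl.
have -> : \sum_(i < n) \sum_j y j * d j = n%:R * \sum_i y i * d i.
  by rewrite sumr_const card_ord mulr_natl.
by rewrite n0; ring.
Qed.

(* The round Laplacian is the sum of the squares of the rotation fields, which
   are tangent to the sphere: no orthonormal tangent frame is needed. *)
Lemma lapSy_rot F p : twice_differentiable F -> sph p.1.1 ->
  \sum_i \sum_(j | j != i)
    ('D_(rot_velocity p i j) (fun x => 'D_(rot_velocity p i j) F x) p
     - 'D_(rot_accel p i j) F p) = 2 * lapSy F p.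
Proof.
move=> F2 y1; have [Fd Fd2] := F2.
rewrite /lapSy -(rot_sum (fun i => Dd (ey R i) F p)
  (fun i j => Dd (ey R j) (Dd (ey R i) F) p) y1).
apply: eq_bigr => i _; apply: eq_bigr => j _.
by rewrite derive2_dirE// derive_dirD// !derive_dirZ.
Qed.

Lemma arc_rotE p i j (s : R) k :
  (circle_arc p (rot_accel p i j) (rot_velocity p i j) s).1.1 ord0 k =
  p.1.1 ord0 k + (cos s - 1) * (p.1.1 ord0 i * (k == i)%:R + p.1.1 ord0 j * (k == j)%:R)
   + sin s * (p.1.1 ord0 i * (k == j)%:R - p.1.1 ord0 j * (k == i)%:R).
Proof. by rewrite /circle_arc /= !mxE eqxx. Qed.

Lemma sph_arc p i j (s : R) : sph p.1.1 -> j != i ->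
  sph (circle_arc p (rot_accel p i j) (rot_velocity p i j) s).1.1.
Proof.
rewrite /sph => y1 ji.
under eq_bigr do rewrite arc_rotE.
rewrite (bigD1 i)//= (bigD1 j)//= -[RHS]y1 [RHS](bigD1 i)//= [in RHS](bigD1 j)//=.
have ij : (i == j) = false by rewrite eq_sym (negPf ji).
rewrite !eqxx (negPf ji) ij.
have -> : \sum_(k < n | (k != i) && (k != j)) (p.1.1 ord0 k +
     (cos s - 1) * (p.1.1 ord0 i * (k == i)%:R + p.1.1 ord0 j * (k == j)%:R) +
     sin s * (p.1.1 ord0 i * (k == j)%:R - p.1.1 ord0 j * (k == i)%:R)) ^+ 2 =
  \sum_(k < n | (k != i) && (k != j)) p.1.1 ord0 k ^+ 2.
  by apply: eq_bigr => k /andP[/negPf-> /negPf->]; rewrite !mulr0 addr0 subrr !mulr0 !addr0.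
have cs : cos s ^+ 2 = 1 - sin s ^+ 2 by have := cos2Dsin2 s; lra.
move: (p.1.1 ord0 i) (p.1.1 ord0 j) (\sum_(_ < n | _) _) => a b S.
rewrite !addrA; congr (_ + S).
transitivity ((cos s ^+ 2 + sin s ^+ 2) * (a ^+ 2 + b ^+ 2)); first by rewrite /=; ring.
by rewrite cs; ring.
Qed.

Lemma arc_rot2 p i j (s : R) :
  (circle_arc p (rot_accel p i j) (rot_velocity p i j) s).1.2 = p.1.2 /\
  (circle_arc p (rot_accel p i j) (rot_velocity p i j) s).2 = p.2.
Proof.
by split; rewrite /circle_arc /= !(scaler0, addr0, subr0, oppr0) //;
  rewrite !mulr0 !addr0 ?subr0 !mulr0 !addr0.
Qed.

Lemma near_arc p B C (P : pt -> Prop) : (\forall q \near p, P q) ->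
  exists2 e : R, 0 < e & forall s, `|s| < e -> P (circle_arc p B C s).
Proof.
move=> nP.
have ac : {for (0 : R), continuous (circle_arc p B C)}.
  by have [ad _] := is_derive_arc p B C 0; exact/differentiable_continuous/derivable1_diffP.
have : \forall s \near (0 : R), P (circle_arc p B C s) by apply: ac; rewrite arc0.
move=> [e /= e0 He]; exists e => // s se; apply: He.
by rewrite /= sub0r normrN.
Qed.

(** Rotation arcs through [p] stay on the sphere, so every summand in [lapSy_rot] is the second
    derivative of [F] along a curve on which it has a local maximum. *)
Lemma lapSy_le0_at_max F p : twice_differentiable F -> sph p.1.1 ->
  (\forall q \near p, sph q.1.1 -> q.1.2 = p.1.2 -> q.2 = p.2 -> F q <= F p) ->
  lapSy F p <= 0.
Proof.
move=> F2 y1 Fmax; rewrite -(@pmulr_rle0 _ 2)// -lapSy_rot//.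
apply: sumr_le0 => i _; apply: sumr_le0 => j ji.
have [e e0 He] := near_arc (rot_accel p i j) (rot_velocity p i j) Fmax.
apply: (proj2 (arc_max F2 e0 _)) => s /He; apply.
- exact: sph_arc.
- by case: (arc_rot2 p i j s).
- by case: (arc_rot2 p i j s).
Qed.

Lemma lapSy_eq0 F p : twice_differentiable F -> sph p.1.1 ->
  (forall y, sph y -> F (y, p.1.2, p.2) = F p) -> lapSy F p = 0.
Proof.
move=> F2 y1 Fcst; suff /eqP : 2 * lapSy F p = 0.
  by rewrite mulf_eq0 pnatr_eq0 /= => /eqP.
rewrite -lapSy_rot// big1// => i _; rewrite big1// => j ji.
apply: arc_cst => // s; have := sph_arc s y1 ji.
case: (arc_rot2 p i j s).
by case: (circle_arc _ _ _ s) => -[y' z'] t' /= -> -> /Fcst.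
Qed.

Definition ypart p : pt := (p.1.1, 0, 0).

Lemma row_sum_ey y : ((y, 0, 0) : pt) = \sum_i y ord0 i *: ey R i.
Proof.
have sumE (r : seq 'I_n) (f : 'I_n -> pt) : \sum_(i <- r) f i =
    (\sum_(i <- r) (f i).1.1, \sum_(i <- r) (f i).1.2, \sum_(i <- r) (f i).2).
  elim: r => [|i r IH]; first by rewrite !big_nil.
  by rewrite !big_cons IH; case: (f i) => -[].
rewrite sumE /=; congr (_, _, _).
- by rewrite [LHS]row_sum_delta.
- by rewrite big1// => i _; rewrite scaler0.
- by rewrite big1// => i _; exact: mulr0.
Qed.

(** Trace of the Hessian minus derivatives along the radial vector [ypart p]: in this form the
    behaviour under orthogonal maps can be read off. *)
Lemma lapSyE F p : twice_differentiable F -> lapSy F p =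
  \sum_i 'D_(ey R i) (fun x => 'D_(ey R i) F x) p
  - 'D_(ypart p) (fun x => 'D_(ypart p) F x) p - n.-1%:R * 'D_(ypart p) F p.
Proof.
move=> F2; have [Fd Fd2] := F2.
rewrite /lapSy /ypart row_sum_ey; congr (_ - _ - _ * _); last by rewrite derive_dir_sum.
rewrite derive2_dir_suml//; apply: eq_bigr => i _.
by rewrite derive_dir_sum// mulr_sumr; apply: eq_bigr => j _; rewrite mulrA.
Qed.

Definition y_reflect v p : pt := (p.1.1 - (2 * dot v p.1.1) *: v, p.1.2, p.2).

Lemma dotDr v y1 y2 : dot v (y1 + y2) = dot v y1 + dot v y2.
Proof. by rewrite -big_split/=; apply: eq_bigr => i _; rewrite mxE mulrDr. Qed.

Lemma dotZr v k y : dot v (k *: y) = k * dot v y.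
Proof. by rewrite mulr_sumr; apply: eq_bigr => i _; rewrite mxE mulrCA. Qed.

Fact y_reflect_linear v : linear (y_reflect v).
Proof.
move=> k p q; rewrite /y_reflect /=; congr (_, _, _).
transitivity (k *: (p.1.1 - (2 * dot v p.1.1) *: v) + (q.1.1 - (2 * dot v q.1.1) *: v)).
  by rewrite dotDr dotZr mulrDr scalerDl opprD scalerBr !scalerA addrACA mulrCA.
by [].
Qed.

HB.instance Definition _ v :=
  GRing.isLinear.Build R pt pt *:%R (y_reflect v) (y_reflect_linear v).

Definition yz_swap p : pt := (p.1.2, p.1.1, p.2).

Fact yz_swap_linear : linear yz_swap.
Proof. by []. Qed.

HB.instance Definition _ := GRing.isLinear.Build R pt pt *:%R yz_swap yz_swap_linear.

Lemma fst_fst_continuous : continuous (fun p : pt => p.1.1).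
Proof. by move=> p; apply: continuous_comp; exact: cvg_fst. Qed.

Lemma fst_snd_continuous : continuous (fun p : pt => p.1.2).
Proof. by move=> p; apply: continuous_comp; [exact: cvg_fst|exact: cvg_snd]. Qed.

Lemma dot_differentiable v y : differentiable (dot v) y.
Proof.
have -> : dot v = \sum_i (fun z : 'rV[R]_n => v ord0 i * z ord0 i).
  by apply/funext => z; rewrite fct_sumE.
apply: differentiable_sum => i.
by apply: differentiableZ; exact: differentiable_coord.
Qed.

Lemma dot_continuous v : continuous (dot v).
Proof. by move=> y; exact/differentiable_continuous/dot_differentiable. Qed.

Lemma continuous_pair (S T U : topologicalType) (f : S -> T) (g : S -> U) :
  continuous f -> continuous g -> continuous (fun x => (f x, g x)).
Proof. by move=> fc gc x; apply: cvg_pair; [exact: fc|exact: gc]. Qed.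

Lemma y_reflect_continuous v : continuous (y_reflect v).
Proof.
apply: (continuous_pair (continuous_pair _ fst_snd_continuous)); last first.
  by move=> p; exact: cvg_snd.
move=> p; apply: cvgB; first exact: fst_fst_continuous.
apply: cvgZr_tmp; apply: cvgMl_tmp.
apply: (@continuous_comp _ _ _ (fun p : pt => p.1.1) (dot v)); first exact: fst_fst_continuous.
exact: dot_continuous.
Qed.

Lemma yz_swap_continuous : continuous yz_swap.
Proof.
apply: (continuous_pair (continuous_pair fst_snd_continuous fst_fst_continuous)).
by move=> p; exact: cvg_snd.
Qed.

Lemma derive_swap F x p : 'D_x (fun q => F (yz_swap q)) p = 'D_(yz_swap x) F (yz_swap p).
Proof. exact: (@derive_comp_linear R _ (yz_swap : {linear pt -> pt})). Qed.

Lemma twice_differentiable_yz_swap F : twice_differentiable F ->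
  twice_differentiable (fun q => F (yz_swap q)).
Proof.
apply: (@twice_differentiable_comp R _ (yz_swap : {linear pt -> pt})).
exact: yz_swap_continuous.
Qed.

Lemma derive_reflect v F x p :
  'D_x (fun q => F (y_reflect v q)) p = 'D_(y_reflect v x) F (y_reflect v p).
Proof. exact: (@derive_comp_linear R _ (y_reflect v : {linear pt -> pt})). Qed.

Lemma twice_differentiable_reflect v F : twice_differentiable F ->
  twice_differentiable (fun q => F (y_reflect v q)).
Proof.
apply: (@twice_differentiable_comp R _ (y_reflect v : {linear pt -> pt})).
exact: y_reflect_continuous.
Qed.

(** The reflection carries the radial vector at [p] to the one at the image of [p], so what remains
    is the invariance of the trace of the Hessian, obtained by expanding it on the reflected basis
    [e_i - 2 v_i v]. *)
Lemma lapSy_reflect F v p : twice_differentiable F -> sph v ->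
  lapSy (fun x => F (y_reflect v x)) p = lapSy F (y_reflect v p).
Proof.
move=> F2 v1; have [Fd Fd2] := F2.
have F2r := @twice_differentiable_reflect v F F2.
rewrite (lapSyE p F2r) (lapSyE (y_reflect v p) F2).
have D2 w : 'D_w (fun x => 'D_w (fun x => F (y_reflect v x)) x) p =
    'D_(y_reflect v w) (fun x => 'D_(y_reflect v w) F x) (y_reflect v p).
  rewrite -derive_reflect; congr ('D_w _ p).
  by apply/funext => x; rewrite derive_reflect.
have D1 w : 'D_w (fun x => F (y_reflect v x)) p = 'D_(y_reflect v w) F (y_reflect v p).
  exact: derive_reflect.
set q := y_reflect v p.
suff trE : \sum_i 'D_(ey R i) (fun x => 'D_(ey R i) (fun x => F (y_reflect v x)) x) p =
    \sum_i 'D_(ey R i) (fun x => 'D_(ey R i) F x) q.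
  by refine (congr2 (fun a b => a - b) (congr2 (fun a b => a - b) trE (D2 (ypart p)))
    (congr1 (fun a => n.-1%:R * a) (D1 (ypart p)))).
pose W : pt := (v, 0, 0).
have rE i : y_reflect v (ey R i) = 1 *: ey R i - (2 * v ord0 i) *: W.
  rewrite /y_reflect /ey /W /=; congr (_, _, _).
  - rewrite scale1r; congr (_ - (2 * _) *: _).
    rewrite /dot (bigD1 i)//= mxE !eqxx mulr1 big1 ?addr0// => k ki.
    by rewrite mxE (negPf ki) andbF mulr0.
  - change ((0 : 'rV[R]_n) = 1 *: 0 - (2 * v ord0 i) *: 0).
    by rewrite !scaler0 subr0.
  - change ((0 : R) = 1 * 0 - (2 * v ord0 i) * 0).
    by rewrite !mulr0 subr0.
pose D (u w : pt) := 'D_w (fun x => 'D_u F x) q.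
have term i : 'D_(ey R i) (fun x => 'D_(ey R i) (fun x => F (y_reflect v x)) x) p =
    1 ^+ 2 * D (ey R i) (ey R i) - 1 * (2 * v ord0 i) * D W (ey R i)
    - 2 * v ord0 i * 1 * D (ey R i) W + (2 * v ord0 i) ^+ 2 * D W W.
  transitivity (D (y_reflect v (ey R i)) (y_reflect v (ey R i))); first exact: D2.
  by rewrite rE; exact: derive2_dirE.
have WE : W = \sum_i v ord0 i *: ey R i by exact: row_sum_ey.
have suml w : \sum_i v ord0 i * D (ey R i) w = D W w.
  by have := derive2_dir_suml (fun i => v ord0 i) (ey R (n:=n)) w q F2; rewrite -WE.
have sumr u : \sum_i v ord0 i * D u (ey R i) = D u W.
  by have := derive_dir_sum (fun i => v ord0 i) (ey R (n:=n)) (Fd2 u q); rewrite -WE.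
transitivity (\sum_i (1 ^+ 2 * D (ey R i) (ey R i) - 1 * (2 * v ord0 i) * D W (ey R i)
    - 2 * v ord0 i * 1 * D (ey R i) W + (2 * v ord0 i) ^+ 2 * D W W)).
  by apply: eq_bigr => i _; exact: term.
transitivity (\sum_i D (ey R i) (ey R i)); last by [].
move: D suml sumr {term} => D suml sumr.
have -> : \sum_i (1 ^+ 2 * D (ey R i) (ey R i) - 1 * (2 * v ord0 i) * D W (ey R i)
    - 2 * v ord0 i * 1 * D (ey R i) W + (2 * v ord0 i) ^+ 2 * D W W) =
  \sum_i D (ey R i) (ey R i) - 2 * (\sum_i v ord0 i * D W (ey R i))
  - 2 * (\sum_i v ord0 i * D (ey R i) W) + 4 * (\sum_i v ord0 i ^+ 2) * D W W.
  rewrite !mulr_sumr mulr_suml -!sumrB -big_split/=.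
  by apply: eq_bigr => i _; ring.
(* The two cross terms contribute [- 2 D W W] each and the last one [4 |v|^2 D W W]; they cancel
   since [|v| = 1]. *)
rewrite sumr suml v1; move: (\sum_i _) (D W W) => a b; ring.
Qed.

End SphereLaplacian.

(** * The Laplacian of a doubly warped product *)

Section WarpedLaplacian.
Local Open Scope classical_set_scope.
Local Open Scope ring_scope.
Context {R : realType} {n : nat}.
Notation pt := (pt R n).
Implicit Types (F : pt -> R) (p q x w : pt) (y v : 'rV[R]_n).
Variables (a E G : R -> R).

(** [lapX] with arbitrary coefficients, so that [E] and [G] can be exchanged: results about the
    [y]-sphere then transfer to the [z]-sphere through [warped_lap_swap]. *)
Definition warped_lap F p : R :=
  Dd (et R n) (Dd (et R n) F) p + a p.2 * Dd (et R n) F p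
  + lapSy F p / E p.2 + lapSz F p / G p.2.

Lemma lapSz_swap F p : lapSz F p = lapSy (fun q => F (yz_swap q)) (yz_swap p).
Proof.
case: p => -[y z] t; set p := (y, z, t).
have swE i : yz_swap (ey R i) = ez R i by [].
have comp_swap (K : pt -> R) i q :
    Dd (ey R i) (fun q => K (yz_swap q)) q = Dd (ez R i) K (yz_swap q).
  by rewrite /Dd derive_swap swE.
have D1 i : Dd (ey R i) (fun q => F (yz_swap q)) = (fun q => Dd (ez R i) F (yz_swap q)).
  by apply/funext => q; exact: comp_swap.
have D2 i j : Dd (ez R j) (Dd (ez R i) F) p =
    Dd (ey R j) (Dd (ey R i) (fun q => F (yz_swap q))) (yz_swap p).
  transitivity (Dd (ey R j) (fun q => Dd (ez R i) F (yz_swap q)) (yz_swap p)).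
    exact: (esym (comp_swap (Dd (ez R i) F) j (yz_swap p))).
  exact: (congr1 (fun f => Dd (ey R j) f (yz_swap p)) (esym (D1 i))).
have D1p i : Dd (ez R i) F p = Dd (ey R i) (fun q => F (yz_swap q)) (yz_swap p).
  exact: (congr1 (fun f => f (yz_swap p)) (esym (D1 i))).
refine (congr2 (fun b c => b - c) (congr2 (fun b c => b - c) _ _)
  (congr1 (fun c => n.-1%:R * c) _)).
- by apply: eq_bigr => i _; exact: D2.
- apply: eq_bigr => i _; apply: eq_bigr => j _.
  exact: (congr1 (fun c => z ord0 i * z ord0 j * c) (D2 i j)).
- apply: eq_bigr => i _; exact: (congr1 (fun c => z ord0 i * c) (D1p i)).
Qed.

Lemma spherical_form_lin (y : 'I_n -> R) (N k : R) b b1 b2 d d1 d2 :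
  (forall i j, b i j = b1 i j - k * b2 i j) -> (forall i, d i = d1 i - k * d2 i) ->
  let L (b : 'I_n -> 'I_n -> R) (d : 'I_n -> R) :=
    \sum_(i < n) b i i - \sum_(i < n) \sum_(j < n) y i * y j * b i j
    - N * \sum_(i < n) y i * d i in
  L b d = L b1 d1 - k * L b2 d2.
Proof.
move=> bE dE L; rewrite /L.
have -> : \sum_i b i i = \sum_i b1 i i - k * \sum_i b2 i i.
  by rewrite mulr_sumr -sumrB; apply: eq_bigr => i _; exact: bE.
have -> : \sum_i y i * d i = \sum_i y i * d1 i - k * \sum_i y i * d2 i.
  by rewrite mulr_sumr -sumrB; apply: eq_bigr => i _; rewrite dE; ring.
have -> : \sum_i \sum_j y i * y j * b i j = \sum_i \sum_j y i * y j * b1 i j -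
    k * \sum_i \sum_j y i * y j * b2 i j.
  rewrite mulr_sumr -sumrB; apply: eq_bigr => i _.
  by rewrite mulr_sumr -sumrB; apply: eq_bigr => j _; rewrite bE; ring.
by ring.
Qed.

Section Linearity.
Variables (F H : pt -> R) (k : R).
Hypotheses (F2 : twice_differentiable F) (H2 : twice_differentiable H).

Lemma DdBZ x p : Dd x (fun q => F q - k * H q) p = Dd x F p - k * Dd x H p.
Proof.
have [Fd _] := F2; have [Hd _] := H2; have [kHd _] := twice_differentiableZ k H2.
have kHE : 'D_x (fun q => k * H q) p = k * 'D_x H p.
  by apply: (@deriveZ _ _ _ H); exact: diff_derivable.
rewrite /Dd -kHE; apply: deriveB; exact: diff_derivable.
Qed.

Lemma Dd2BZ x w p : Dd w (Dd x (fun q => F q - k * H q)) p =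
  Dd w (Dd x F) p - k * Dd w (Dd x H) p.
Proof.
rewrite /Dd (derive2B x w p F2 (twice_differentiableZ k H2)).
by rewrite (derive2Z k x w p H2).
Qed.

End Linearity.

Lemma lapSyBZ F (H : pt -> R) k p : twice_differentiable F -> twice_differentiable H ->
  lapSy (fun q => F q - k * H q) p = lapSy F p - k * lapSy H p.
Proof.
move=> F2 H2; apply: spherical_form_lin => [i j|i].
- exact: Dd2BZ.
- exact: DdBZ.
Qed.

Lemma warped_lapBZ F (H : pt -> R) k p : twice_differentiable F -> twice_differentiable H ->
  warped_lap (fun q => F q - k * H q) p = warped_lap F p - k * warped_lap H p.
Proof.
move=> F2 H2; rewrite /warped_lap !lapSz_swap lapSyBZ//.
rewrite (lapSyBZ k (yz_swap p) (twice_differentiable_yz_swap F2) (twice_differentiable_yz_swap H2)).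
rewrite (Dd2BZ k F2 H2) (DdBZ k F2 H2).
move: (Dd _ _ p) (Dd _ _ p) (Dd _ _ p) (Dd _ _ p) (lapSy _ _) (lapSy _ _) (lapSy _ _) (lapSy _ _).
by move=> *; ring.
Qed.

(** The maximum is tested separately in [y], [z] and [t]. The first [t]-derivative vanishes there,
    which removes the term in [a] whatever its sign. *)
Lemma warped_lap_le0_at_max F p : twice_differentiable F -> sph p.1.1 -> sph p.1.2 ->
  0 < E p.2 -> 0 < G p.2 ->
  (\forall q \near p, sph q.1.1 -> sph q.1.2 -> F q <= F p) -> warped_lap F p <= 0.
Proof.
move=> F2 y1 z1 E0 G0 Fmax.
have lapy : lapSy F p <= 0.
  apply: lapSy_le0_at_max => //; apply: filterS Fmax => q Fq qy qz _.
  by apply: Fq => //; rewrite qz.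
have lapz : lapSz F p <= 0.
  rewrite lapSz_swap; apply: lapSy_le0_at_max => //; first exact: twice_differentiable_yz_swap.
  have swapK : yz_swap (yz_swap p) = p by case: p {y1 z1 E0 G0 Fmax lapy} => -[].
  have : \forall q \near yz_swap p,
      sph (yz_swap q).1.1 -> sph (yz_swap q).1.2 -> F (yz_swap q) <= F p.
    have sc : yz_swap q @[q --> yz_swap p] --> p.
      by rewrite -[X in _ --> X]swapK; exact: yz_swap_continuous.
    exact: (sc (fun q => sph q.1.1 -> sph q.1.2 -> F q <= F p) Fmax).
  apply: filterS => q /= Fq qy qz qt; rewrite swapK.
  by apply: Fq => //; rewrite qz.
(* With zero acceleration the arc is [p + sin s *: et], so only [t] moves. *)
have [e e0 He] := near_arc 0 (et R n) Fmax.
have Fa s : `|s| < e -> F (circle_arc p 0 (et R n) s) <= F p.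
  have aE : (circle_arc p 0 (et R n) s).1 = p.1.
    transitivity (p.1 + (cos s - 1) *: (0 : 'rV[R]_n * 'rV[R]_n)
      + sin s *: (0 : 'rV[R]_n * 'rV[R]_n)); first by [].
    by rewrite !scaler0 !addr0.
  by move=> /He; rewrite aE; exact.
have [t1 t2] := arc_max F2 e0 Fa.
have tt0 : Dd (et R n) (Dd (et R n) F) p <= 0.
  move: t2; rewrite (_ : 'D_0 F p = 0) ?subr0//.
  by case: F2 => Fd _; rewrite deriveE// linear0.
have -> : warped_lap F p = Dd (et R n) (Dd (et R n) F) p + a p.2 * 0
    + lapSy F p / E p.2 + lapSz F p / G p.2.
  exact: (congr1 (fun c => Dd (et R n) (Dd (et R n) F) p + a p.2 * c
    + lapSy F p / E p.2 + lapSz F p / G p.2) t1).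
rewrite mulr0 addr0.
have yle := mulr_le0_ge0 lapy (ltW (_ : 0 < (E p.2)^-1)).
have zle := mulr_le0_ge0 lapz (ltW (_ : 0 < (G p.2)^-1)).
rewrite !invr_gt0 in yle zle.
exact: (ler_wnDr (zle G0) (ler_wnDr (yle E0) tt0)).
Qed.

Lemma dot0r v : dot v 0 = 0.
Proof. by rewrite /dot big1// => i _; rewrite mxE mulr0. Qed.

Lemma dotC v y : dot v y = dot y v.
Proof. by apply: eq_bigr => i _; rewrite mulrC. Qed.

Lemma sphE y : sph y <-> dot y y = 1.
Proof. by rewrite /sph /dot; under eq_bigr do rewrite expr2. Qed.

Lemma warped_lap_reflect F v p : twice_differentiable F -> sph v ->
  warped_lap (fun q => F (y_reflect v q)) p = warped_lap F (y_reflect v p).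
Proof.
move=> F2 v1.
have D1 x q : y_reflect v x = x ->
    Dd x (fun q => F (y_reflect v q)) q = Dd x F (y_reflect v q).
  by move=> xE; rewrite -[in RHS]xE; exact: derive_reflect.
have D2 x w : y_reflect v x = x -> y_reflect v w = w ->
    Dd w (Dd x (fun q => F (y_reflect v q))) p = Dd w (Dd x F) (y_reflect v p).
  move=> xE wE; transitivity (Dd w (fun q => Dd x F (y_reflect v q)) p).
    have E1 : Dd x (fun q => F (y_reflect v q)) = (fun q => Dd x F (y_reflect v q)).
      by apply/funext => q; exact: D1.
    exact: (congr1 (fun f => Dd w f p) E1).
  have := derive_reflect v (Dd x F) w p; rewrite wE; exact.
have tE : y_reflect v (et R n) = et R n by rewrite /y_reflect /et /= dot0r mulr0 scale0r subr0.
have zE i : y_reflect v (ez R i) = ez R i.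
  by rewrite /y_reflect /ez /= dot0r mulr0 scale0r subr0.
have lapz : lapSz (fun q => F (y_reflect v q)) p = lapSz F (y_reflect v p).
  have sum_eq b b' (d d' : 'I_n -> R) : (forall i j : 'I_n, b i j = b' i j) ->
      (forall i, d i = d' i) ->
      \sum_(i < n) b i i - \sum_i \sum_j p.1.2 ord0 i * p.1.2 ord0 j * b i j
        - n.-1%:R * \sum_i p.1.2 ord0 i * d i =
      \sum_(i < n) b' i i - \sum_i \sum_j p.1.2 ord0 i * p.1.2 ord0 j * b' i j
        - n.-1%:R * \sum_i p.1.2 ord0 i * d' i.
    move=> bE dE; have -> : b = b' by apply/funext => i; apply/funext => j.
    by have -> : d = d' by apply/funext.
  by apply: sum_eq => [i j|i]; [exact: D2|exact: D1].
have combine c1 c2 c3 c4 c1' c2' c3' c4' : c1 = c1' -> c2 = c2' -> c3 = c3' -> c4 = c4' ->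
    c1 + a p.2 * c2 + c3 / E p.2 + c4 / G p.2 =
    c1' + a p.2 * c2' + c3' / E p.2 + c4' / G p.2 by move=> -> -> -> ->.
exact: (combine _ _ _ _ _ _ _ _ (D2 _ _ tE tE) (D1 _ _ tE) (lapSy_reflect p F2 v1) lapz).
Qed.

End WarpedLaplacian.

Lemma warped_lap_swap {R : realType} {n : nat} (a E G : R -> R) (F : pt R n -> R) (p : pt R n) :
  warped_lap a E G (fun q => F (yz_swap q)) p =
  warped_lap a G E F (yz_swap p).
Proof.
have swapK q : yz_swap (yz_swap q) = q by case: q => -[].
have D1 q : Dd (et R n) (fun q => F (yz_swap q)) q = Dd (et R n) F (yz_swap q).
  exact: (derive_swap F (et R n) q).
have D2 : Dd (et R n) (Dd (et R n) (fun q => F (yz_swap q))) p =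
    Dd (et R n) (Dd (et R n) F) (yz_swap p).
  transitivity (Dd (et R n) (fun q => Dd (et R n) F (yz_swap q)) p).
    have E1 : Dd (et R n) (fun q => F (yz_swap q)) = (fun q => Dd (et R n) F (yz_swap q)).
      by apply/funext => q; exact: D1.
    exact: (congr1 (fun f => Dd (et R n) f p) E1).
  exact: (derive_swap (Dd (et R n) F) (et R n) p).
have ly : lapSy (fun q => F (yz_swap q)) p = lapSz F (yz_swap p).
  by rewrite lapSz_swap swapK.
have lz : lapSz (fun q => F (yz_swap q)) p = lapSy F (yz_swap p).
  rewrite lapSz_swap.
  have E2 : (fun q => F (yz_swap (yz_swap q))) = F by apply/funext => q; rewrite swapK.
  exact: (congr1 (fun f => lapSy f (yz_swap p)) E2).
have combine c1 c2 c3 c4 c1' c2' c3' c4' : c1 = c1' -> c2 = c2' -> c3 = c3' -> c4 = c4' ->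
    c1 + a p.2 * c2 + c3 / E p.2 + c4 / G p.2 =
    c1' + a p.2 * c2' + c4' / G p.2 + c3' / E p.2.
  by move=> -> -> -> ->; rewrite addrAC.
exact: (combine _ _ _ _ _ _ _ _ D2 (D1 p) ly lz).
Qed.

(** * Separable functions of [t] and of a height on the [y]-sphere *)

Section Barrier.
Local Open Scope classical_set_scope.
Local Open Scope ring_scope.
Context {R : realType} {n : nat}.
Notation pt := (pt R n).
Implicit Types (p q x w : pt) (y v : 'rV[R]_n) (k dk g dg : R -> R).

(** Used with a quadratic [g] as the barrier on a half sphere, and with [g = 1] for functions of [t]
    alone. *)
Definition sep v k g : pt -> R := fun p => k p.2 * g (dot v p.1.1).

Lemma is_derive_line (f : pt -> R) p x d :
  is_derive (0 : R) 1 (fun h => f (h *: x + p)) d -> is_derive p x f d.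
Proof.
have E : (fun h : R => h^-1 *: (((fun h => f (h *: x + p)) \o shift 0) (h *: 1) - f (0 *: x + p))) =
         (fun h : R => h^-1 *: ((f \o shift p) (h *: x) - f p)).
  apply/funext => h /=; rewrite scale0r add0r addr0.
  by have -> : h *: (1 : R) = h by exact: mulr1.
by move=> [fd fE]; apply: DeriveDef; rewrite /derivable /derive -E.
Qed.

Lemma sep_differentiable v k dk g dg p :
  (forall t : R, is_derive t 1 k (dk t)) -> (forall t : R, is_derive t 1 g (dg t)) ->
  differentiable (sep v k g) p.
Proof.
move=> kd gd.
have snd_diff (T1 T2 : normedModType R) (z : T1 * T2) : differentiable (fun u : T1 * T2 => u.2) z.
  by apply: (linear_differentiable (f := snd)) => u; exact: cvg_snd.
have fst_diff (T1 T2 : normedModType R) (z : T1 * T2) : differentiable (fun u : T1 * T2 => u.1) z.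
  by apply: (linear_differentiable (f := fst)) => u; exact: cvg_fst.
apply: differentiableM.
  apply: (differentiable_comp (f := fun q : pt => q.2) (g := k)); first exact: snd_diff.
  by have [kp _] := kd p.2; exact/derivable1_diffP.
apply: (differentiable_comp (f := fun q : pt => dot v q.1.1) (g := g)).
  apply: (differentiable_comp (f := fun q : pt => q.1.1) (g := dot v)).
    apply: (differentiable_comp (f := fun q : pt => q.1) (g := fun u => u.1)) => //;
    exact: fst_diff.
  exact: dot_differentiable.
by have [gp _] := gd (dot v p.1.1); exact/derivable1_diffP.
Qed.

Lemma derive_sep v k dk g dg x p :
  (forall t : R, is_derive t 1 k (dk t)) -> (forall t : R, is_derive t 1 g (dg t)) ->
  is_derive p x (sep v k g) (dot v x.1.1 * sep v k dg p + x.2 * sep v dk g p).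
Proof.
move=> kd gd; apply: is_derive_line.
have lE (A B t : R) : is_derive t 1 (fun h => h * A + B) A.
  by apply: is_derive_eq; rewrite /GRing.scale /= mulr1 mulr0 add0r addr0.
have E : (fun h : R => sep v k g (h *: x + p)) =
    (fun h => k (h * x.2 + p.2) * g (h * dot v x.1.1 + dot v p.1.1)).
  by apply/funext => h; rewrite /sep /= dotDr dotZr.
rewrite E.
have kl : is_derive (0 : R) 1 (fun h => k (h * x.2 + p.2)) (dk p.2 * x.2).
  have := is_derive_compF (g := fun h => h * x.2 + p.2) (kd (0 * x.2 + p.2)) (lE x.2 p.2 0).
  by rewrite mul0r add0r.
have gl : is_derive (0 : R) 1 (fun h => g (h * dot v x.1.1 + dot v p.1.1))
    (dg (dot v p.1.1) * dot v x.1.1).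
  have := is_derive_compF (g := fun h => h * dot v x.1.1 + dot v p.1.1)
    (gd (0 * dot v x.1.1 + dot v p.1.1)) (lE (dot v x.1.1) (dot v p.1.1) 0).
  by rewrite mul0r add0r.
refine (is_derive_eq (is_deriveMF kl gl) _).
rewrite !mul0r !add0r /sep; ring.
Qed.

Section SeparableFunction.
Variables (v : 'rV[R]_n) (k dk ddk g dg ddg : R -> R).
Hypotheses (kd : forall t : R, is_derive t 1 k (dk t))
  (kd2 : forall t : R, is_derive t 1 dk (ddk t))
  (gd : forall t : R, is_derive t 1 g (dg t))
  (gd2 : forall t : R, is_derive t 1 dg (ddg t)).

Lemma Dd_sep x p : Dd x (sep v k g) p =
  dot v x.1.1 * sep v k dg p + x.2 * sep v dk g p.
Proof. by have [_ E] := derive_sep v x p kd gd. Qed.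

Lemma Dd2_sep x w p : Dd w (Dd x (sep v k g)) p =
  dot v x.1.1 * (dot v w.1.1 * sep v k ddg p + w.2 * sep v dk dg p)
  + x.2 * (dot v w.1.1 * sep v dk dg p + w.2 * sep v ddk g p).
Proof.
have -> : Dd x (sep v k g) = (fun q => dot v x.1.1 * sep v k dg q + x.2 * sep v dk g q).
  by apply/funext => q; exact: Dd_sep.
have d1 := derive_sep v w p kd gd2.
have d2 := derive_sep v w p kd2 gd.
have c1 := is_derive_cstF (dot v x.1.1) p w.
have c2 := is_derive_cstF x.2 p w.
have [_ E] := is_deriveDF (is_deriveMF c1 d1) (is_deriveMF c2 d2).
by rewrite /Dd E !mulr0 !addr0.
Qed.

Lemma twice_differentiable_sep : twice_differentiable (sep v k g).
Proof.
split=> [p|x p]; first exact: sep_differentiable kd gd.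
have -> : (fun q => 'D_x (sep v k g) q) =
    (fun q => dot v x.1.1 * sep v k dg q + x.2 * sep v dk g q).
  by apply/funext => q; exact: Dd_sep.
apply: differentiableD; apply: differentiableZ.
- exact: sep_differentiable kd gd2.
- exact: sep_differentiable kd2 gd.
Qed.

Lemma dot_delta i : dot v (delta_mx ord0 i) = v ord0 i.
Proof.
rewrite /dot (bigD1 i)//= mxE !eqxx mulr1 big1 ?addr0// => j ji.
by rewrite mxE (negPf ji) andbF mulr0.
Qed.

(** On functions of the height [s = <v, y>] the round Laplacian acts as the ultraspherical operator
    [(1 - s^2) g'' - (n-1) s g']. *)
Lemma warped_lap_sep (a E G : R -> R) p : sph v ->
  warped_lap a E G (sep v k g) p =
  (ddk p.2 + a p.2 * dk p.2) * g (dot v p.1.1) +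
  k p.2 * ((1 - dot v p.1.1 ^+ 2) * ddg (dot v p.1.1)
           - n.-1%:R * dot v p.1.1 * dg (dot v p.1.1)) / E p.2.
Proof.
move=> v1.
have lz : lapSz (sep v k g) p = 0.
  have D1 i : Dd (ez R i) (sep v k g) p = 0 by rewrite Dd_sep /= dot0r !mul0r addr0.
  have D2 i j : Dd (ez R j) (Dd (ez R i) (sep v k g)) p = 0.
    by rewrite Dd2_sep /= dot0r !mul0r addr0.
  rewrite /lapSz big1 => [|i _]; last exact: D2.
  rewrite big1 => [|i _]; last by rewrite big1 => // j _; rewrite D2 mulr0.
  by rewrite big1 => [|i _]; rewrite ?D1 ?mulr0 // !subr0.
have ly : lapSy (sep v k g) p = k p.2 * ((1 - dot v p.1.1 ^+ 2) * ddg (dot v p.1.1)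
           - n.-1%:R * dot v p.1.1 * dg (dot v p.1.1)).
  have D1 i : Dd (ey R i) (sep v k g) p = v ord0 i * sep v k dg p.
    by rewrite Dd_sep /= dot_delta mul0r addr0.
  have D2 i j : Dd (ey R j) (Dd (ey R i) (sep v k g)) p = v ord0 i * v ord0 j * sep v k ddg p.
    by rewrite Dd2_sep /= !dot_delta !mul0r !addr0 mulrA.
  rewrite /lapSy.
  have -> : \sum_i Dd (ey R i) (Dd (ey R i) (sep v k g)) p = sep v k ddg p.
    transitivity (\sum_i v ord0 i ^+ 2 * sep v k ddg p).
      by apply: eq_bigr => i _; rewrite D2 expr2.
    by rewrite -mulr_suml v1 mul1r.
  have -> : \sum_i \sum_j p.1.1 ord0 i * p.1.1 ord0 j * Dd (ey R j) (Dd (ey R i) (sep v k g)) p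
      = dot v p.1.1 ^+ 2 * sep v k ddg p.
    transitivity (\sum_i \sum_j (v ord0 i * p.1.1 ord0 i) * (v ord0 j * p.1.1 ord0 j)
      * sep v k ddg p).
      by apply: eq_bigr => i _; apply: eq_bigr => j _; rewrite D2; ring.
    rewrite expr2 {1}/dot !mulr_suml; apply: eq_bigr => i _.
    by rewrite {1}/dot !mulr_sumr mulr_suml.
  have -> : \sum_i p.1.1 ord0 i * Dd (ey R i) (sep v k g) p = dot v p.1.1 * sep v k dg p.
    by rewrite mulr_suml; apply: eq_bigr => i _; rewrite D1; ring.
  by rewrite /sep; ring.
have ltt : Dd (et R n) (Dd (et R n) (sep v k g)) p = ddk p.2 * g (dot v p.1.1).
  by rewrite Dd2_sep /= dot0r !mul0r !add0r !mul1r.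
have lt1 : Dd (et R n) (sep v k g) p = dk p.2 * g (dot v p.1.1).
  by rewrite Dd_sep /= dot0r mul0r add0r mul1r.
rewrite /warped_lap lz ly ltt lt1 mul0r addr0; ring.
Qed.

End SeparableFunction.

End Barrier.

(** * Comparison with a reflected eigenfunction on a half sphere *)

Section ReflectionComparison.
Local Open Scope classical_set_scope.
Local Open Scope ring_scope.
Context {R : realType} {n : nat}.
Notation pt := (pt R n).
Implicit Types (p q : pt) (y z v : 'rV[R]_n).

Lemma sph_le1 y i : sph y -> `|y ord0 i| <= 1.
Proof.
move=> y1; rewrite -(@expr_le1 _ 2)// real_normK ?num_real// -y1.
by rewrite (bigD1 i)//= lerDl sumr_ge0// => j _; exact: sqr_ge0.
Qed.

Lemma sqnorm_continuous : continuous (fun y : 'rV[R]_n => \sum_i y ord0 i ^+ 2).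
Proof.
have -> : (fun y : 'rV[R]_n => \sum_i y ord0 i ^+ 2) =
    \sum_(i < n) (fun y : 'rV[R]_n => y ord0 i * y ord0 i).
  by apply/funext => y; rewrite fct_sumE; apply: eq_bigr => i _; rewrite expr2.
move=> y; apply: differentiable_continuous; apply: differentiable_sum => i.
by apply: differentiableM; exact: differentiable_coord.
Qed.

Lemma sph_compact : compact [set y : 'rV[R]_n | sph y].
Proof.
pose I : set R := [set` `[(- 1), 1]].
have box : compact [set y : 'rV[R]_n | forall i, I (y ord0 i)].
  by apply: (@rV_compact R n (fun=> I)) => _; exact: segment_compact.
apply: (subclosed_compact _ box) => [|y y1 i]; last first.
  by rewrite /I /= in_itv /= -ler_norml; exact: sph_le1.
have /continuous_closedP := sqnorm_continuous.
have one_closed : closed [set x : R | x = 1] by exact: closed_eq.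
by move=> /(_ _ one_closed).
Qed.

Lemma half_sphere_compact v : compact [set y : 'rV[R]_n | sph y /\ 0 <= dot v y].
Proof.
apply: (compact_closedI sph_compact).
have /continuous_closedP := @dot_continuous R n v.
have ge0_closed : closed [set x : R | 0 <= x] by exact: closed_ge.
by move=> /(_ _ ge0_closed).
Qed.

Lemma dot_le1 v y : sph v -> sph y -> dot v y <= 1.
Proof.
rewrite !sphE => v1 y1.
have : 0 <= \sum_i (v ord0 i - y ord0 i) ^+ 2 by apply: sumr_ge0 => i _; exact: sqr_ge0.
have -> : \sum_i (v ord0 i - y ord0 i) ^+ 2 = dot v v - 2 * dot v y + dot y y.
  by rewrite /dot mulr_sumr -sumrB -big_split; apply: eq_bigr => i _ /=; ring.
by rewrite v1 y1; lra.
Qed.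

Lemma sph_y_reflect v p : sph v -> sph p.1.1 -> sph (y_reflect v p).1.1.
Proof.
rewrite !sphE => v1 y1; rewrite /y_reflect /=.
set c := 2 * _.
have -> : dot (p.1.1 - c *: v) (p.1.1 - c *: v) =
    dot p.1.1 p.1.1 - 2 * c * dot v p.1.1 + c ^+ 2 * dot v v.
  rewrite /dot !mulr_sumr -sumrB -big_split; apply: eq_bigr => i _ /=.
  by rewrite !mxE; ring.
by rewrite v1 y1 /c; ring.
Qed.

(** The constant [2 c / N] in [g] is chosen so that [N g / U] cancels the [- 2 c] coming from [g''].
    What is left of the spherical part is [(N + 2) c s^2 / U], and
    [(N + 2) c s^2 <= eta s / 2 < eta g] because [c <= 1/2] gives [g > s / 2]. *)
Lemma barrier_lt0 (N lam mu U s c eta g : R) : g = 2 * c / N + s - c * s ^+ 2 ->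
  0 < N -> 0 < U -> 0 < c -> c <= 1 / 2 ->
  c * (2 * (N + 2)) <= eta -> eta <= (lam - mu) * U ^+ 2 -> 0 <= s <= 1 ->
  (N / U - lam * U) * g
    + U * ((1 - s ^+ 2) * (- 2 * c) - N * s * (1 - 2 * c * s)) / U ^+ 2
    + mu * (U * g) < 0.
Proof.
move=> gE N0 U0 c0 c1 ceta etaU s01.
have Un0 : U != 0 by rewrite gt_eqF.
have Nn0 : N != 0 by rewrite gt_eqF.
have -> : (N / U - lam * U) * g
    + U * ((1 - s ^+ 2) * (- 2 * c) - N * s * (1 - 2 * c * s)) / U ^+ 2
    + mu * (U * g) = ((N + 2) * c * s ^+ 2 - (lam - mu) * U ^+ 2 * g) / U.
  by rewrite gE; field; apply/andP; split.
rewrite pmulr_llt0 ?invr_gt0// subr_lt0.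
have s2 : s ^+ 2 <= s by rewrite expr2; nra.
have cN : 0 < 2 * c / N by apply: divr_gt0; lra.
have gs : s / 2 < g.
  have : c * s ^+ 2 <= 1 / 2 * s by apply: ler_pM => //; [lra|exact: sqr_ge0].
  by rewrite gE; lra.
have c2 : 0 < c * (2 * (N + 2)) by apply: mulr_gt0; lra.
have eta0 : 0 < eta by lra.
apply: (@le_lt_trans _ _ (eta * (s / 2))).
  have : (N + 2) * c * s ^+ 2 <= eta / 2 * s.
    by apply: ler_pM; [apply: mulr_ge0; lra|exact: sqr_ge0|lra|].
  by lra.
apply: (@lt_le_trans _ _ (eta * g)); first by rewrite ltr_pM2l.
by rewrite ler_wpM2r//; lra.
Qed.

Variables (a E G u du ddu : R -> R) (lam mu T : R) (F : pt -> R).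
Hypotheses (n1 : (1 < n)%N) (T0 : 0 < T) (mulam : mu < lam).
Hypotheses (u0 : forall t, 0 < u t) (Eu : forall t, E t = u t ^+ 2) (G0 : forall t, 0 < G t).
Hypotheses (uT : forall t, u (t + T) = u t)
  (ud : forall t : R, is_derive t 1 u (du t)) (ud2 : forall t : R, is_derive t 1 du (ddu t))
  (uE : forall t, ddu t + a t * du t + lam * u t = n.-1%:R / u t).
Hypotheses (F2 : twice_differentiable F)
  (FT : forall y z t, sph y -> sph z -> F (y, z, t + T) = F (y, z, t))
  (FE : forall y z t, sph y -> sph z -> - warped_lap a E G F (y, z, t) = mu * F (y, z, t)).

(* Comparison with [u(t) (2c/(n-1) + <v,y> - c <v,y>^2)], a perturbation of the
   coordinate function [u(t) <v,y>] that stays positive up to the boundary of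
   the half sphere while remaining a strict supersolution for [mu < lam]. *)
Lemma reflection_le v y z t : sph v -> sph y -> sph z -> 0 <= dot v y ->
  F (y, z, t) <= F (y_reflect v (y, z, t)).
Proof.
move=> v1 y1 z1 vy; rewrite leNgt; apply/negP => Flt.
pose N : R := n.-1%:R.
have N0 : 0 < N by rewrite /N ltr0n; case: n n1 => [|[]].
have TT := T0; have muL := mulam.
have tT : t <= t + T by lra.
have uc : continuous u by move=> x; exact: is_derive_continuous (ud x).
(* The minimum of [u] over a period makes [eta], and hence [c], independent of the point where the
   barrier is tested. *)
have [tm tmI um] := EVT_min tT (continuous_subspaceT uc).
pose eta := (lam - mu) * u tm ^+ 2.
have eta0 : 0 < eta by apply: mulr_gt0; [lra|exact: exprn_gt0].
pose c := Num.min (1 / 2) (eta / (2 * (N + 2))).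
have N2 : 0 < 2 * (N + 2) by lra.
have c0 : 0 < c by rewrite lt_min; apply/andP; split; [lra|exact: divr_gt0].
have c1 : c <= 1 / 2 by rewrite ge_min lexx.
have c2 : c * (2 * (N + 2)) <= eta by rewrite -ler_pdivlMr// ge_min lexx orbT.
pose g s := 2 * c / N + s - c * s ^+ 2.
have g0 s : 0 <= s <= 1 -> 0 < g s.
  move=> s01; have : 0 < 2 * c / N by apply: divr_gt0; lra.
  have : c * s ^+ 2 <= 1 * s by rewrite expr2; nra.
  by rewrite /g; lra.
have gd (s : R) : is_derive s 1 g (1 - 2 * c * s).
  by apply: is_derive_eq; rewrite /GRing.scale /=; ring.
have gd2 (s : R) : is_derive s 1 (fun s => 1 - 2 * c * s) (- 2 * c).
  by apply: is_derive_eq; rewrite /GRing.scale /=; ring.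
pose w := sep v u g.
have w2 : twice_differentiable w := twice_differentiable_sep v ud ud2 gd gd2.
have Fr2 := twice_differentiable_reflect v F2.
pose H q := F q - 1 * F (y_reflect v q).
have H2 : twice_differentiable H :=
  twice_differentiableB F2 (twice_differentiableZ 1 Fr2).
pose K : set pt := ([set y | sph y /\ 0 <= dot v y] `*` [set z | sph z])
  `*` `[t, t + T].
have Kc : compact K.
  apply: compact_setX; last exact: segment_compact.
  by apply: compact_setX; [exact: half_sphere_compact|exact: sph_compact].
have w0 q : sph q.1.1 -> 0 <= dot v q.1.1 -> 0 < w q.
  move=> qy qv; apply: mulr_gt0 => //; apply: g0.
  by rewrite qv; exact: dot_le1.
have diffc (f : pt -> R) : twice_differentiable f -> continuous f.
  by case=> fd _ q; exact: differentiable_continuous.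
have Kp : K (y, z, t) by rewrite /K /=; split; [split|rewrite in_itv /= lexx tT].
have hc : {within K, continuous (fun q => H q / w q)}.
  apply: continuous_in_subspaceT => q; rewrite inE => -[[[/= qy qv] qz] qt].
  apply: cvgM; first exact: diffc.
  by apply: cvgV; [rewrite gt_eqF// w0|exact: diffc].
(* The maximum [M] of [H / w] is the least multiple of the barrier lying above [H] on the half
   sphere over one period; [p0] is a point of contact. *)
have [|p0] := compact_EVT_max _ Kc hc; first by exists (y, z, t).
rewrite inE => -[[[/= p0y p0v] p0z] p0t] p0max.
pose M := H p0 / w p0.
have w00 : 0 < w p0 by exact: w0.
have M0 : 0 < M.
  apply: (lt_le_trans _ (p0max (y, z, t) _)); last by rewrite inE.
  by apply: divr_gt0; [rewrite /H mul1r subr_gt0|exact: w0].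
have Hp0 : H p0 = M * w p0 by rewrite /M divfK// gt_eqF.
(* Contact on the equator is impossible: the reflection fixes [p0] there, so [H p0 = 0], whereas
   [M * w p0 > 0]. *)
have p0v' : 0 < dot v p0.1.1.
  rewrite lt_neqAle p0v andbT; apply/eqP => v0.
  move: Hp0; rewrite /H mul1r (_ : y_reflect v p0 = p0) ?subrr; last first.
    rewrite /y_reflect -v0 mulr0 scale0r subr0.
    by move: (p0) => -[[y' z'] t'].
  by move=> /esym/eqP; rewrite gt_eqF// mulr_gt0.
pose D q := H q - M * w q.
have D2 : twice_differentiable D :=
  twice_differentiableB H2 (twice_differentiableZ M w2).
have Dp0 : D p0 = 0 by rewrite /D Hp0 subrr.
(* Periodicity extends [D <= 0] to one more period on either side, so [p0] is a local maximum even
   if its time is an endpoint of [[t, t + T]]. *)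
have DT y' z' s : sph y' -> sph z' -> D (y', z', s + T) = D (y', z', s).
  move=> y'1 z'1; rewrite /D /H /w /sep /y_reflect /= uT !FT//.
  exact: (sph_y_reflect (p := (y', z', s))).
have DK q : K q -> D q <= 0.
  move=> Kq; have [[[/= qy qv] _] _] := Kq.
  rewrite subr_le0 -ler_pdivrMr; last exact: w0.
  by apply: p0max; rewrite inE.
have Dwin y' z' s : sph y' -> 0 <= dot v y' -> sph z' -> t - T <= s <= t + T + T ->
    D (y', z', s) <= 0.
  move=> y'1 vy' z'1 sT; have [st|ts] := ltP s t.
    rewrite -DT//; apply: DK; split=> //=; rewrite in_itv /=; lra.
  have [tTs|sTt] := ltP (t + T) s; last by apply: DK; split=> //=; rewrite in_itv /= ts.
  rewrite -[s](subrK T) DT//; apply: DK; split=> //=; rewrite in_itv /=; lra.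
have Dnear : \forall q \near p0, sph q.1.1 -> sph q.1.2 -> D q <= D p0.
  have n1' : \forall q \near p0, 0 < dot v q.1.1.
    have vc : {for p0, continuous (fun q : pt => dot v q.1.1)}.
      apply: (@continuous_comp _ _ _ (fun q : pt => q.1.1) (dot v)).
        exact: fst_fst_continuous.
      exact: dot_continuous.
    exact: (cvgr_gt _ vc).
  have tc : {for p0, continuous (fun q : pt => q.2)} by exact: cvg_snd.
  have /= := p0t; rewrite in_itv /= => p0t'.
  have n2 : \forall q \near p0, t - T < q.2 by apply: (cvgr_gt _ tc); lra.
  have n3 : \forall q \near p0, q.2 < t + T + T by apply: (cvgr_lt _ tc); lra.
  near=> q; move=> qy qz; rewrite Dp0.
  have q1 : 0 < dot v q.1.1 by near: q.
  have q2 : t - T < q.2 by near: q.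
  have q3 : q.2 < t + T + T by near: q.
  move: qy qz q1 q2 q3; clear -Dwin; case: q => -[y' z'] s /= qy qz q1 q2 q3.
  by apply: Dwin => //; lra.
have E0 s : 0 < E s by rewrite Eu exprn_gt0.
(* Contradiction to come: since [H p0 = M * w p0], the Laplacian of [D] at [p0] is
   [- M (warped_lap w + mu w)], which is positive by [barrier_lt0]. *)
have := warped_lap_le0_at_max a D2 p0y p0z (E0 _) (G0 _) Dnear.
rewrite (warped_lapBZ a E G M p0 H2 w2) (warped_lapBZ a E G 1 p0 F2 Fr2).
rewrite (warped_lap_reflect a E G p0 F2 v1).
have lapF q : sph q.1.1 -> sph q.1.2 -> warped_lap a E G F q = - (mu * F q).
  case: q => -[y' z'] s /= y'1 z'1; apply/eqP; rewrite -eqr_oppLR; apply/eqP; exact: FE.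
rewrite lapF// lapF//; last exact: sph_y_reflect.
rewrite (warped_lap_sep ud ud2 gd gd2 a E G p0 v1).
set s := dot v p0.1.1; set U := u p0.2.
have etaU : eta <= (lam - mu) * U ^+ 2.
  have uU : u tm <= U by exact: um.
  have := u0 tm; have := u0 p0.2; rewrite -/U => U0 um0.
  apply: ler_wpM2l; first by lra.
  by apply: lerXn2r => //; rewrite nnegrE ltW.
have s01 : 0 <= s <= 1 by rewrite p0v; exact: dot_le1.
have := barrier_lt0 (erefl (g s)) N0 (u0 p0.2) c0 c1 c2 etaU s01.
rewrite -/U /=.
have -> : ddu p0.2 + a p0.2 * du p0.2 = N / U - lam * U.
  by have := uE p0.2; rewrite -/U -/N; lra.
rewrite Eu -/U -/N.
have -> : mu * (U * g s) = mu * w p0 by [].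
set L := _ + _ / _ => Lneg.
have -> : - (mu * F p0) - 1 * - (mu * F (y_reflect v p0)) = - (mu * (M * w p0)).
  by rewrite -Hp0 /H; ring.
have : M * (L + mu * w p0) < 0 by rewrite pmulr_rlt0.
by rewrite mulrDr mulrCA; lra.
Unshelve. all: by end_near.
Qed.

(** The reflection along the unit vector [v] in the direction [y - y'] sends [y] to [y'], and
    [<v, y> = |y - y'| / 2] is nonnegative. Exchanging [y] and [y'] yields equality. *)
Lemma y_independent y y' z t : sph y -> sph y' -> sph z -> F (y, z, t) <= F (y', z, t).
Proof.
move=> y1 y'1 z1; have [->//|yy'] := eqVneq y y'.
pose d := y - y'; pose m := dot d d.
have yd : dot y y = 1 by exact/sphE.
have y'd : dot y' y' = 1 by exact/sphE.
have dE (b c e : 'rV[R]_n) : dot (b - c) e = dot b e - dot c e.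
  by rewrite /dot -sumrB; apply: eq_bigr => i _; rewrite !mxE; ring.
have dy : dot d y = m / 2.
  rewrite /m /d !dE ![dot _ (_ - _)]dotC !dE yd y'd [dot y' y]dotC; lra.
have m0 : 0 < m.
  rewrite lt_neqAle sumr_ge0 ?andbT; last by move=> i _; rewrite -expr2 sqr_ge0.
  apply: contra yy' => /eqP/esym m0; rewrite -subr_eq0; apply/eqP/rowP => i.
  rewrite [RHS]mxE; apply/eqP; rewrite -sqrf_eq0.
  have := psumr_eq0P (fun i _ => (_ : 0 <= d ord0 i * d ord0 i)) m0.
  by rewrite expr2 => ->//= j; rewrite -expr2 sqr_ge0.
pose k := (Num.sqrt m)^-1.
have k2 : k ^+ 2 = m^-1 by rewrite exprVn sqr_sqrtr// ltW.
pose v := k *: d.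
have vE b : dot v b = k * dot d b.
  by rewrite dotC dotZr dotC.
have v1 : sph v by apply/sphE; rewrite vE dotC vE mulrA -expr2 k2 mulVf// gt_eqF.
have vy : 0 <= dot v y.
  by rewrite vE dy mulr_ge0 ?invr_ge0 ?sqrtr_ge0// divr_ge0// ltW.
have := reflection_le t v1 y1 z1 vy.
rewrite /y_reflect /= vE dy /v scalerA.
have -> : 2 * (k * (m / 2)) * k = 1.
  have -> : 2 * (k * (m / 2)) * k = k ^+ 2 * m by field.
  by rewrite k2 mulVf// gt_eqF.
by rewrite scale1r /d opprB addrC subrK.
Qed.

End ReflectionComparison.

(** * The Carlotto-Schulz profile *)

Section TrigonometricIdentities.
Context {R : realType}.
Implicit Types (s c x y p q N : R).

(* [s, c, x, y, p, q] stand for sine and cosine of [r], [al] and [th]; [al'] is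
   [alpha_rate] and [(n-1)/2 (ln EG)'] is [log_rate]. *)
Definition alpha_rate N s c x y p q : R :=
  (N * (q / p - p / q) * y - (2 * N + 1) * c * x) / s.

Definition log_rate N s c x y p q : R :=
  N * (2 * c * y + (q / p - p / q) * x) / s.

(** This is [u'' + a u' + (2N+1) u = N / u] for [u = sin r cos th]. It expresses that the
    coordinates [u y_i] of a minimal hypersurface of dimension [2n-1] are eigenfunctions for [2n-1],
    the term [N / u] being the share of the [y]-sphere. *)
Lemma warping_identity N s c x y p q : s != 0 -> p != 0 -> q != 0 ->
  s ^+ 2 + c ^+ 2 = 1 -> x ^+ 2 + y ^+ 2 = 1 -> p ^+ 2 + q ^+ 2 = 1 ->
  (- s * y ^+ 2 * q - alpha_rate N s c x y p q * (c * x * q + y * p)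
     - x / s * (c * y * p + x * q))
  + log_rate N s c x y p q * (c * y * q - x * p) + (2 * N + 1) * (s * q) =
  N / (s * q).
Proof.
move=> s0 p0 q0 sc xy pq; apply/eqP; rewrite -subr_eq0; apply/eqP.
(* An explicit combination of the three Pythagorean relations, one for each angle. *)
transitivity ((N * (- (q / p - p / q) * p * (x ^+ 2 + y ^+ 2 - 1)
    + 2 * c ^+ 2 * q * (x ^+ 2 + y ^+ 2 - 1) + 2 * q * (s ^+ 2 + c ^+ 2 - 1)
    + (p ^+ 2 + q ^+ 2 - 1) / q)
    + q * (x ^+ 2 * (s ^+ 2 + c ^+ 2 - 1) - s ^+ 2 * (x ^+ 2 + y ^+ 2 - 1))) / s).
  rewrite /alpha_rate /log_rate; field; do ?[apply/andP; split] => //.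
by rewrite sc xy pq subrr !(mulr0, mul0r, addr0, subr0).
Qed.

(** The same property for the last coordinate [cos r], which depends on [t] only and so satisfies
    the homogeneous radial equation. *)
Lemma height_identity N s c x y p q : s != 0 -> p != 0 -> q != 0 ->
  x ^+ 2 + y ^+ 2 = 1 ->
  - c * y ^+ 2 + s * x * alpha_rate N s c x y p q
  + log_rate N s c x y p q * (- s * y) + (2 * N + 1) * c = 0.
Proof.
move=> s0 p0 q0 xy.
transitivity (- (2 * N + 1) * c * (x ^+ 2 + y ^+ 2 - 1)).
  rewrite /alpha_rate /log_rate; field; do ?[apply/andP; split] => //.
by rewrite xy subrr mulr0.
Qed.

End TrigonometricIdentities.

Section CarlottoSchulz.
Local Open Scope classical_set_scope.
Local Open Scope ring_scope.
Context {R : realType} (n : nat) (n1 : (1 < n)%N).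
Variables (r th al : R -> R) (T r0 : R).
Hypotheses (rd : forall t : R, is_derive t 1 r (cos (al t)))
  (thd : forall t : R, is_derive t 1 th (sin (al t) / sin (r t)))
  (ald : forall t : R, is_derive t 1 al
     ((2 * n - 2)%:R / sin (r t) * cos (al t) * (cos (2 * th t) / sin (2 * th t))
      - (2 * n - 1)%:R * (cos (r t) / sin (r t)) * sin (al t)))
  (r_0 : r 0 = pi / 2) (al_0 : al 0 = 0)
  (th_q : th (- (T / 4)) = pi / 4)
  (al_q : al (- (T / 4)) = - (pi / 2))
  (th_sym : forall t, th (- t) = th t /\ th (T / 2 - t) = pi / 2 - th t)
  (r_sym : forall t, r (- t) = pi - r t /\ r (T / 2 - t) = r t)
  (al_sym : forall t, al (- t) = - al t /\ al (T / 2 - t) = pi - al t)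
  (th_mono : forall s t : R, 0 <= s -> s < t -> t <= T / 2 -> th s < th t)
  (r_mono : forall s t : R, - (T / 4) <= s -> s < t -> t <= T / 4 -> r s < r t)
  (bounds : forall t, (0 < th t < pi / 2) /\ (0 < r t < pi)).

Notation N := (n.-1%:R : R).
Notation lam := ((2 * n - 1)%:R : R).
Notation a := (coefEG n r th).

Lemma N_gt0 : 0 < N.
Proof. by rewrite ltr0n; case: n n1 => [|[]]. Qed.

Lemma lamE : lam = 2 * N + 1.
Proof.
case: n n1 => [//|m] _ /=.
have -> : (2 * m.+1 - 1 = 2 * m + 1)%N by lia.
by rewrite natrD natrM.
Qed.

Lemma sin_r_gt0 t : 0 < sin (r t).
Proof. by have [_ rt] := bounds t; exact: sin_gt0_pi. Qed.

Lemma sin_th_gt0 t : 0 < sin (th t).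
Proof.
have [/andP[t0 t1] _] := bounds t; apply: sin_gt0_pi; rewrite t0 /=.
by have := pi_gt0 R; lra.
Qed.

Lemma cos_th_gt0 t : 0 < cos (th t).
Proof.
have [/andP[t0 t1] _] := bounds t; apply: cos_gt0_pihalf; rewrite t1 andbT.
by have := pi_gt0 R; lra.
Qed.

Let sr0 t : sin (r t) != 0. Proof. by rewrite gt_eqF// sin_r_gt0. Qed.
Let st0 t : sin (th t) != 0. Proof. by rewrite gt_eqF// sin_th_gt0. Qed.
Let ct0 t : cos (th t) != 0. Proof. by rewrite gt_eqF// cos_th_gt0. Qed.
Let sc1 (x : R) : sin x ^+ 2 + cos x ^+ 2 = 1. Proof. by rewrite addrC cos2Dsin2. Qed.

Let B t := alpha_rate N (sin (r t)) (cos (r t)) (sin (al t)) (cos (al t))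
  (sin (th t)) (cos (th t)).

Let A t := log_rate N (sin (r t)) (cos (r t)) (sin (al t)) (cos (al t))
  (sin (th t)) (cos (th t)).

Lemma is_derive_al (t : R) : is_derive t 1 al (B t).
Proof.
refine (is_derive_eq (ald t) _).
have -> : 2 * th t = th t *+ 2 by rewrite mulr_natl.
have -> : (2 * n - 2)%:R = 2 * N :> R.
  by case: n n1 => [//|m] _; rewrite -natrM; congr (_%:R); lia.
rewrite cos_mulr2n sin_mulr2n lamE /B /alpha_rate.
have -> : cos (th t) ^+ 2 *+ 2 - 1 = cos (th t) ^+ 2 - sin (th t) ^+ 2.
  by rewrite -(sc1 (th t)); ring.
by field; rewrite sr0 st0 ct0.
Qed.

Let srd (t : R) : is_derive t 1 (fun t => sin (r t)) (cos (r t) * cos (al t)).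
Proof. exact: is_derive_sinF (rd t). Qed.
Let crd (t : R) : is_derive t 1 (fun t => cos (r t)) (- sin (r t) * cos (al t)).
Proof. exact: is_derive_cosF (rd t). Qed.
Let sad (t : R) : is_derive t 1 (fun t => sin (al t)) (cos (al t) * B t).
Proof. exact: is_derive_sinF (is_derive_al t). Qed.
Let cad (t : R) : is_derive t 1 (fun t => cos (al t)) (- sin (al t) * B t).
Proof. exact: is_derive_cosF (is_derive_al t). Qed.
Let std (t : R) : is_derive t 1 (fun t => sin (th t)) (cos (th t) * (sin (al t) / sin (r t))).
Proof. exact: is_derive_sinF (thd t). Qed.
Let ctd (t : R) : is_derive t 1 (fun t => cos (th t)) (- sin (th t) * (sin (al t) / sin (r t))).
Proof. exact: is_derive_cosF (thd t). Qed.

Definition uy t := sin (r t) * cos (th t).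
Definition uz t := sin (r t) * sin (th t).

Let duy t := cos (r t) * cos (al t) * cos (th t) - sin (al t) * sin (th t).
Let duz t := cos (r t) * cos (al t) * sin (th t) + sin (al t) * cos (th t).
(** This and the next two are defined by solving the expected equation for the second derivative;
    the [is_derive2] lemmas show that they are the actual derivatives. *)
Let dduy t := N / uy t - lam * uy t - a t * duy t.
Let dduz t := N / uz t - lam * uz t - a t * duz t.
Let ddcr t := - lam * cos (r t) - a t * (- sin (r t) * cos (al t)).

Lemma uy_gt0 t : 0 < uy t.
Proof. by rewrite mulr_gt0 ?sin_r_gt0 ?cos_th_gt0. Qed.

Lemma uz_gt0 t : 0 < uz t.
Proof. by rewrite mulr_gt0 ?sin_r_gt0 ?sin_th_gt0. Qed.

Lemma is_derive_uy (t : R) : is_derive t 1 uy (duy t).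
Proof.
refine (is_derive_eq (is_deriveMF (srd t) (ctd t)) _).
by rewrite /duy; field; exact: sr0.
Qed.

Lemma is_derive_uz (t : R) : is_derive t 1 uz (duz t).
Proof.
refine (is_derive_eq (is_deriveMF (srd t) (std t)) _).
by rewrite /duz; field; exact: sr0.
Qed.

Lemma coefE t : a t = A t.
Proof.
have EG s : Ew r th s * Gw r th s = (uy s * uz s) ^+ 2.
  by rewrite /Ew /Gw /uy /uz; ring.
have EGt : 0 < (uy t * uz t) ^+ 2 by rewrite exprn_gt0// mulr_gt0 ?uy_gt0 ?uz_gt0.
have d1 := is_deriveXF 2 (is_deriveMF (is_derive_uy t) (is_derive_uz t)).
have [_ d2] := is_derive_compF (g := fun s => (uy s * uz s) ^+ 2) (is_derive1_ln EGt) d1.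
have lnE : (fun s => ln (Ew r th s * Gw r th s)) = (fun s => ln ((uy s * uz s) ^+ 2)).
  by apply/funext => s; rewrite EG.
rewrite /coefEG lnE derive1E d2 /A /log_rate /duy /duz /uy /uz /=.
by field; rewrite sr0 st0 ct0.
Qed.

Lemma is_derive2_uy (t : R) : is_derive t 1 duy (dduy t).
Proof.
refine (is_derive_eq (is_deriveBF (is_deriveMF (is_deriveMF (crd t) (cad t)) (ctd t))
  (is_deriveMF (sad t) (std t))) _).
have := warping_identity N (sr0 t) (st0 t) (ct0 t) (sc1 (r t)) (sc1 (al t)) (sc1 (th t)).
rewrite -/(A t) -/(B t) -coefE /dduy lamE /duy /uy => <-.
by field; exact: sr0.
Qed.

Lemma is_derive2_uz (t : R) : is_derive t 1 duz (dduz t).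
Proof.
refine (is_derive_eq (is_deriveDF (is_deriveMF (is_deriveMF (crd t) (cad t)) (std t))
  (is_deriveMF (sad t) (ctd t))) _).
have x1 : (- sin (al t)) ^+ 2 + cos (al t) ^+ 2 = 1 by rewrite sqrrN.
have p1 : cos (th t) ^+ 2 + sin (th t) ^+ 2 = 1 by rewrite addrC.
(* the symmetry [th -> pi/2 - th], [al -> - al] exchanges [uy] and [uz] *)
have := warping_identity N (sr0 t) (ct0 t) (st0 t) (sc1 (r t)) x1 p1.
have -> : alpha_rate N (sin (r t)) (cos (r t)) (- sin (al t)) (cos (al t))
    (cos (th t)) (sin (th t)) = - B t by rewrite /B /alpha_rate; field; rewrite sr0 st0 ct0.
have -> : log_rate N (sin (r t)) (cos (r t)) (- sin (al t)) (cos (al t))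
    (cos (th t)) (sin (th t)) = a t.
  by rewrite coefE /A /log_rate; field; rewrite sr0 st0 ct0.
rewrite /dduz lamE /duz /uz => <-.
by field; exact: sr0.
Qed.

Lemma is_derive2_cos_r (t : R) :
  is_derive t 1 (fun t => - sin (r t) * cos (al t)) (ddcr t).
Proof.
refine (is_derive_eq (is_deriveMF (is_deriveNF (srd t)) (cad t)) _).
have := height_identity N (cos (r t)) (sr0 t) (st0 t) (ct0 t) (sc1 (al t)).
rewrite -/(A t) -/(B t) -coefE /ddcr lamE => H.
by apply/eqP; rewrite -subr_eq0 -H; apply/eqP; ring.
Qed.

(** The volume density [(E G)^((n-1)/2)], an integrating factor for the radial equation. *)
Definition weight t := (uy t * uz t) ^+ n.-1.

Lemma weight_gt0 t : 0 < weight t.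
Proof. by rewrite exprn_gt0// mulr_gt0 ?uy_gt0 ?uz_gt0. Qed.

Lemma is_derive_weight (t : R) : is_derive t 1 weight (a t * weight t).
Proof.
refine (is_derive_eq (is_deriveXF n.-1 (is_deriveMF (is_derive_uy t) (is_derive_uz t))) _).
rewrite coefE /weight.
have -> : (uy t * uz t) ^+ n.-1 = uy t * uz t * (uy t * uz t) ^+ n.-1.-1.
  by rewrite -exprS prednK// -(ltr0n R) N_gt0.
rewrite mulrAC [RHS]mulrA; congr (_ * _).
rewrite /A /log_rate /duy /duz /uy /uz.
by field; rewrite sr0 st0 ct0.
Qed.

Hypothesis T0 : 0 < T.

Lemma coef_continuous : continuous a.
Proof.
have -> : a = A by apply/funext => t; exact: coefE.
move=> t.
have K := is_deriveBF (is_deriveMF (ctd t) (is_deriveVF (st0 t) (std t)))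
  (is_deriveMF (std t) (is_deriveVF (ct0 t) (ctd t))).
have D := is_deriveDF (is_deriveMF (is_deriveMF (is_derive_cstF 2 t 1) (crd t)) (cad t))
  (is_deriveMF K (sad t)).
exact: is_derive_continuous (is_deriveMF (is_deriveMF (is_derive_cstF N t 1) D)
  (is_deriveVF (sr0 t) (srd t))).
Qed.

(** Oddness of [a] about a point means that reflection in it maps solutions of the radial equation
    to solutions; [coef_half] and [coef_period] give this about [T/4] and [T/2]. *)
Lemma coef_odd t : a (- t) = - a t.
Proof.
rewrite !coefE /A /log_rate; have [-> _] := r_sym t; have [-> _] := al_sym t.
have [-> _] := th_sym t.
have -> : sin (pi - r t) = sin (r t) by rewrite sinB sinpi cospi; ring.
have -> : cos (pi - r t) = - cos (r t) by rewrite cosB sinpi cospi; ring.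
by rewrite sinN cosN; field; rewrite sr0 st0 ct0.
Qed.

Lemma coef_half t : a (T / 2 - t) = - a t.
Proof.
rewrite !coefE /A /log_rate; have [_ ->] := r_sym t; have [_ ->] := al_sym t.
have [_ ->] := th_sym t.
have -> : sin (pi / 2 - th t) = cos (th t) by rewrite sinB sin_pihalf cos_pihalf; ring.
have -> : cos (pi / 2 - th t) = sin (th t) by rewrite cosB sin_pihalf cos_pihalf; ring.
have -> : sin (pi - al t) = sin (al t) by rewrite sinB sinpi cospi; ring.
have -> : cos (pi - al t) = - cos (al t) by rewrite cosB sinpi cospi; ring.
by field; rewrite sr0 st0 ct0.
Qed.

Lemma coef_period t : a (T - t) = - a t.
Proof.
have -> : T - t = T / 2 - (t - T / 2) by lra.
by rewrite coef_half -coef_odd opprB coef_half.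
Qed.

Lemma cos_r_lt0 (t : R) : 0 < t < T / 2 -> cos (r t) < 0.
Proof.
move=> tT.
have neg s : 0 < s <= T / 4 -> cos (r s) < 0.
  move=> sT; have rs : r 0 < r s by apply: r_mono; lra.
  have [_ rb] := bounds s.
  have : 0 < sin (r s - pi / 2) by apply: sin_gt0_pi; rewrite r_0 in rs; lra.
  by rewrite sinB sin_pihalf cos_pihalf; lra.
have [t4|t4] := leP t (T / 4); first by apply: neg; lra.
by have [_ <-] := r_sym t; apply: neg; lra.
Qed.

Lemma cos_r_le0 (t : R) : 0 <= t <= T / 2 -> cos (r t) <= 0.
Proof.
move=> tT; have [->|t0] := eqVneq t 0; first by rewrite r_0 cos_pihalf.
have [->|t2] := eqVneq t (T / 2).
  by have [_] := r_sym 0; rewrite subr0 => ->; rewrite r_0 cos_pihalf.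
apply/ltW/cos_r_lt0; rewrite !lt_neqAle t2 eq_sym t0 /=; lra.
Qed.

Lemma th_lt_pi4 (t : R) : - (T / 4) < t < T / 4 -> th t < pi / 4.
Proof.
have th4 : th (T / 4) = pi / 4 by have [<- _] := th_sym (T / 4).
have pos s : 0 <= s < T / 4 -> th s < pi / 4.
  by move=> sT; rewrite -th4; have TT := T0; apply: th_mono; lra.
move=> tT; have [t0|t0] := leP 0 t; first by apply: pos; lra.
by have [<- _] := th_sym t; apply: pos; lra.
Qed.

Lemma uz_lt_uy (t : R) : - (T / 4) < t < T / 4 -> uz t < uy t.
Proof.
move=> /th_lt_pi4 tp; rewrite ltr_pM2l ?sin_r_gt0//.
have -> : cos (th t) = sin (pi / 2 - th t) by rewrite sinB sin_pihalf cos_pihalf; ring.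
have [/andP[t0 t1] _] := bounds t.
by rewrite ltr_sin ?in_itv /=; lra.
Qed.

Lemma uz_eq_uy (t : R) : t = T / 4 \/ t = - (T / 4) -> uz t = uy t.
Proof.
have th4 : th t = pi / 4 -> uz t = uy t.
  rewrite /uz /uy => ->; congr (_ * _).
  have -> : sin (pi / 4) = sin (pi / 2 - pi / 4) :> R by congr sin; lra.
  by rewrite sinB sin_pihalf cos_pihalf; ring.
by case=> tE; apply: th4; rewrite tE//; have [<- _] := th_sym (T / 4).
Qed.

(** * Dirichlet problems for the radial equation *)

Section Solutions.
Variables (mu : R) (f df ddf : R -> R).
Hypotheses (mu_le : mu <= lam)
  (fd : forall t : R, is_derive t 1 f (df t)) (fd2 : forall t : R, is_derive t 1 df (ddf t))
  (fE : forall t, ddf t + a t * df t + mu * f t = 0).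

Lemma solution_unique (t0 : R) : f t0 = 0 -> df t0 = 0 -> forall t, f t = 0.
Proof. exact: linear_ode_unique coef_continuous fd fd2 fE. Qed.

(** The midpoint carries zero Cauchy data: one-sided comparison of [f] and of [- f] there forces
    [df] to vanish. *)
Lemma solution_eq0_itv (s t : R) : s < t -> (forall x, s <= x <= t -> f x = 0) ->
  forall x, f x = 0.
Proof.
move=> st f0; pose m := (s + t) / 2.
have fm : f m = 0 by apply: f0; rewrite /m; lra.
have e0 : 0 < t - m by rewrite /m; lra.
apply: (solution_unique fm); apply/eqP; rewrite eq_le -oppr_ge0.
apply/andP; split.
  apply: (derive_ge0_right (is_deriveNF (fd m)) e0) => x xm.
  by rewrite fm f0 ?oppr0 ?lexx //; rewrite /m in xm; lra.
apply: (derive_ge0_right (fd m) e0) => x xm.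
by rewrite fm f0 ?lexx //; rewrite /m in xm; lra.
Qed.

(** The comparison function [- cos r] is positive inside [[0, T/2]] and solves the equation for
    [lam], hence is a strict supersolution for [mu < lam]. *)
Lemma dirichlet_cos_r (s t : R) : mu < lam -> 0 <= s -> s < t -> t <= T / 2 ->
  f s = 0 -> f t = 0 -> forall x, f x = 0.
Proof.
move=> mul s0 st tT fs ft; apply: (solution_eq0_itv st).
have hd (x : R) := is_deriveNF (crd x).
have hd2 (x : R) := is_deriveNF (is_derive2_cos_r x).
apply: (sturm_dirichlet weight_gt0 is_derive_weight fd fd2 hd hd2 fE _ _ fs ft).
- by move=> x xst; rewrite oppr_ge0; apply: cos_r_le0; lra.
- move=> x xst.
  have -> : - ddcr x + a x * - (- sin (r x) * cos (al x)) + mu * - cos (r x) =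
    (lam - mu) * cos (r x) by rewrite /ddcr; ring.
  by rewrite pmulr_rlt0 ?subr_gt0// cos_r_lt0//; lra.
Qed.

(** Here strictness comes from [N / uy - N / uz < 0], so [uy - uz] still serves at [mu = lam], the
    case needed for [z1]. *)
Lemma dirichlet_uy_uz (t : R) : 0 < t <= T / 4 -> f t = 0 -> f (- t) = 0 -> forall x, f x = 0.
Proof.
move=> tT ft fNt; have tNt : - t < t by lra.
apply: (solution_eq0_itv tNt).
have hd (x : R) := is_deriveBF (is_derive_uy x) (is_derive_uz x).
have hd2 (x : R) := is_deriveBF (is_derive2_uy x) (is_derive2_uz x).
have uyz x : - t < x < t -> uz x < uy x by move=> xt; apply: uz_lt_uy; lra.
apply: (sturm_dirichlet weight_gt0 is_derive_weight fd fd2 hd hd2 fE _ _ fNt ft).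
- move=> x xt; rewrite subr_ge0.
  have [xT|xT] := boolP (- (T / 4) < x < T / 4); first exact/ltW/uz_lt_uy.
  by rewrite uz_eq_uy//; move: xT; rewrite negb_and -!leNgt => /orP[] xT; [right|left]; lra.
- move=> x /uyz xt.
  have -> : dduy x - dduz x + a x * (duy x - duz x) + mu * (uy x - uz x) =
    N * (uz x - uy x) / (uy x * uz x) - (lam - mu) * (uy x - uz x).
    by rewrite /dduy /dduz; field; rewrite !gt_eqF ?uy_gt0 ?uz_gt0.
  have : 0 <= (lam - mu) * (uy x - uz x) by apply: mulr_ge0; rewrite subr_ge0// ltW.
  have : N * (uz x - uy x) / (uy x * uz x) < 0.
    rewrite pmulr_llt0; last by rewrite invr_gt0 mulr_gt0 ?uy_gt0 ?uz_gt0.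
    by rewrite pmulr_rlt0 ?subr_lt0// N_gt0.
  lra.
Qed.

End Solutions.

Lemma is_derive_refl (h dh : R -> R) (c t : R) : (forall x : R, is_derive x 1 h (dh x)) ->
  is_derive t 1 (fun x => h (c - x)) (- dh (c - t)).
Proof.
move=> hd; have cd := is_deriveBF (is_derive_cstF c t 1) (is_derive_idF t).
refine (is_derive_eq (is_derive_compF (g := fun x => c - x) (hd (c - t)) cd) _).
by rewrite sub0r mulrN1.
Qed.

Lemma is_derive2_refl (h dh : R -> R) (c t : R) : (forall x : R, is_derive x 1 h (dh x)) ->
  is_derive t 1 (fun x => - h (c - x)) (dh (c - t)).
Proof. by move=> hd; rewrite -[dh _]opprK; exact: is_deriveNF (is_derive_refl c t hd). Qed.

Lemma is_derive_unique (h : R -> R) (t d e : R) : is_derive t 1 h d -> is_derive t 1 h e -> d = e.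
Proof. by move=> [_ <-] [_ <-]. Qed.

Lemma radial_eq0 (mu : R) (f df ddf : R -> R) : 0 < mu -> mu < lam ->
  (forall t : R, is_derive t 1 f (df t)) -> (forall t : R, is_derive t 1 df (ddf t)) ->
  (forall t, ddf t + a t * df t + mu * f t = 0) ->
  (forall t, f (t + T) = f t) -> forall t, f t = 0.
Proof.
move=> mu0 mul fd fd2 fE fT; have TT := T0.
(* The odd part about [0] vanishes at [0] and, by periodicity, at [T/2]. Writing [0 - t] fits the
   general reflection [c - t]. *)
have even t : f (0 - t) = f t.
  apply/esym/eqP; rewrite -subr_eq0; apply/eqP.
  pose h x := f x - f (0 - x); rewrite -/(h t).
  have hd (x : R) : is_derive x 1 h (df x - - df (0 - x)).
    exact: is_deriveBF (fd x) (is_derive_refl 0 x fd).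
  have hd2 (x : R) : is_derive x 1 (fun x => df x - - df (0 - x)) (ddf x - ddf (0 - x)).
    exact: is_deriveBF (fd2 x) (is_derive2_refl 0 x fd2).
  have T2 : 0 < T / 2 by lra.
  apply: (dirichlet_cos_r hd hd2 _ mul (lexx 0) T2 (lexx _)).
  - move=> x; have := fE x; have := fE (0 - x).
    have aE : a (0 - x) = - a x by rewrite sub0r coef_odd.
    by rewrite aE /h; lra.
  - by rewrite /h subr0 subrr.
  - rewrite /h sub0r; have -> : T / 2 = - (T / 2) + T by lra.
    have -> : - (- (T / 2) + T) = - (T / 2) by lra.
    by rewrite fT subrr.
have evenN t : f (- t) = f t by rewrite -(even t) sub0r.
(* The odd part about [T/4] vanishes at [T/4] and, by periodicity, at [- (T/4)]. *)
have half t : f (T / 2 - t) = f t.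
  apply/esym/eqP; rewrite -subr_eq0; apply/eqP.
  pose h x := f x - f (T / 2 - x); rewrite -/(h t).
  have hd (x : R) : is_derive x 1 h (df x - - df (T / 2 - x)).
    exact: is_deriveBF (fd x) (is_derive_refl (T / 2) x fd).
  have hd2 (x : R) : is_derive x 1 (fun x => df x - - df (T / 2 - x)) (ddf x - ddf (T / 2 - x)).
    exact: is_deriveBF (fd2 x) (is_derive2_refl (T / 2) x fd2).
  have T4 : 0 < T / 4 <= T / 4 by lra.
  apply: (dirichlet_uy_uz (ltW mul) hd hd2 _ T4).
  - move=> x; have := fE x; have := fE (T / 2 - x).
    by rewrite coef_half /h; lra.
  - have T24 : T / 2 - T / 4 = T / 4 by lra.
    by rewrite /h T24 subrr.
  - rewrite /h; have -> : T / 2 - - (T / 4) = - (T / 4) + T by lra.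
    by rewrite fT subrr.
have dfE c t : (forall x, f (c - x) = f x) -> df t = - df (c - t).
  move=> fc; apply: is_derive_unique (fd t) _.
  have -> : f = (fun x => f (c - x)) by apply/funext => x; rewrite fc.
  exact: is_derive_refl.
have df0 : df 0 = 0 by have := dfE 0 0 even; rewrite subr0; lra.
have df4 : df (T / 4) = 0.
  have T24 : T / 2 - T / 4 = T / 4 by lra.
  by have := dfE (T / 2) (T / 4) half; rewrite T24; lra.
(* The derivative of [weight * df] is [- mu * weight * f], so its equal values at [0] and [T/4]
   produce a zero [c] of [f]; by symmetry [T/2 - c] is another. *)
have [||c cT] := @mean_value R (fun t => weight t * df t)
  (fun t => weight t * ddf t + df t * (a t * weight t)) 0 (T / 4).
- by move=> x; exact: is_deriveMF (is_derive_weight x) (fd2 x).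
- lra.
rewrite df0 df4 !mulr0 subrr => /esym/eqP.
have -> : weight c * ddf c + df c * (a c * weight c) = - mu * weight c * f c.
  have -> : ddf c = - (a c * df c) - mu * f c by have := fE c; lra.
  by ring.
rewrite subr0 mulf_eq0 => /orP[|/eqP]; last by lra.
rewrite !mulf_eq0 oppr_eq0 (gt_eqF mu0) (gt_eqF (weight_gt0 c)) /= => /eqP fc.
have cT2 : c < T / 2 - c by lra.
apply: (dirichlet_cos_r fd fd2 fE mul _ cT2) => //; try lra.
by rewrite half.
Qed.

(** * Signs of the even solution for [2n-1] *)

Section EvenSolution.
Variables (z dz ddz : R -> R).
Hypotheses (zd : forall t : R, is_derive t 1 z (dz t))
  (zd2 : forall t : R, is_derive t 1 dz (ddz t))
  (zE : forall t, ddz t + a t * dz t + lam * z t = 0) (z0 : z 0 = 1) (dz0 : dz 0 = 0).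

Let zN t : z (- t) = z t.
Proof.
apply/esym/eqP; rewrite -subr_eq0 -(sub0r t); apply/eqP.
pose h x := z x - z (0 - x); rewrite -/(h t).
have hd (x : R) : is_derive x 1 h (dz x - - dz (0 - x)).
  exact: is_deriveBF (zd x) (is_derive_refl 0 x zd).
have hd2 (x : R) : is_derive x 1 (fun x => dz x - - dz (0 - x)) (ddz x - ddz (0 - x)).
  exact: is_deriveBF (zd2 x) (is_derive2_refl 0 x zd2).
apply: (solution_unique (mu := lam) hd hd2 _ (t0 := 0)).
- move=> x; have := zE x; have := zE (0 - x).
  have aE : a (0 - x) = - a x by rewrite sub0r coef_odd.
    by rewrite aE /h; lra.
- by rewrite /h subr0 subrr.
- by rewrite subr0 dz0; lra.
Qed.

(** A first zero [u <= T/4] would, by evenness, make [z] vanish at both ends of [[-u, u]], hence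
    identically, against [z 0 = 1]. *)
Lemma even_solution_quarter_gt0 : 0 < z (T / 4).
Proof.
have TT := T0; rewrite ltNge; apply/negP => z4.
have zc : continuous z by move=> x; exact: is_derive_continuous (zd x).
have T4 : 0 <= T / 4 by lra.
have [|u [uT zu _]] := zero_after zc z4 T4; first by rewrite z0.
have := dirichlet_uy_uz (lexx _) zd zd2 zE uT zu; rewrite zN => /(_ zu) /(_ 0).
by rewrite z0 => /eqP; rewrite oner_eq0.
Qed.

Let W h dh t := weight t * (dz t * h t - z t * dh t).

Let W_refl (c s t : R) : (forall x, a (c - x) = - a x) ->
  W (fun x => z (c - x)) (fun x => - dz (c - x)) s =
  W (fun x => z (c - x)) (fun x => - dz (c - x)) t.
Proof.
move=> ac; apply: (wronskian_cst (mu := lam) is_derive_weight s t zd zd2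
  (fun x => is_derive_refl c x zd) (fun x => is_derive2_refl c x zd2) zE) => x.
by have := zE (c - x); rewrite ac; lra.
Qed.

Let W_cos_r t : W (fun x => cos (r x)) (fun x => - sin (r x) * cos (al x)) t = weight 0.
Proof.
rewrite -[RHS]mulr1 /W (wronskian_cst (mu := lam) is_derive_weight t 0 zd zd2 crd
  is_derive2_cos_r zE) => [|x]; last by rewrite /ddcr; ring.
by rewrite z0 dz0 r_0 al_0 sin_pihalf cos0; congr (_ * _); ring.
Qed.

(** Signs propagate from [z (T/4) > 0] by constant Wronskians. The one with [cos r] gives
    [dz (T/4) < 0], where [cos al = 0], and [z (T/2) < 0], where [cos r = 0]. The one with a
    reflected copy of [z] reduces to [2 * weight * dz * z] at the centre of reflection and to a
    multiple of [dz] at [0]: centre [T/4] gives [dz (T/2) < 0], then centre [T/2] gives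
    [dz T > 0]. *)
Lemma even_solution_derive_gt0 : 0 < dz T.
Proof.
have TT := T0; have w0 := weight_gt0; have z4 := even_solution_quarter_gt0.
have dz4 : dz (T / 4) < 0.
  have al4 : al (T / 4) = pi / 2.
    by have [H _] := al_sym (T / 4); move: H; rewrite al_q; lra.
  have c4 : cos (r (T / 4)) < 0 by apply: cos_r_lt0; lra.
  have := W_cos_r (T / 4); rewrite /W al4 cos_pihalf !mulr0 subr0 => WE.
  have : 0 < weight (T / 4) * (dz (T / 4) * cos (r (T / 4))) by rewrite WE.
  by rewrite pmulr_rgt0// nmulr_lgt0.
have r2 : r (T / 2) = pi / 2 by have [_] := r_sym 0; rewrite subr0 r_0.
have al2 : al (T / 2) = pi by have [_] := al_sym 0; rewrite subr0 al_0 subr0.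
have z2 : z (T / 2) < 0.
  have := W_cos_r (T / 2); rewrite /W r2 al2 cos_pihalf sin_pihalf cospi mulr0 sub0r.
  rewrite mulN1r opprK mulr1 => WE.
  have : 0 < weight (T / 2) * - z (T / 2) by rewrite WE.
  by rewrite pmulr_rgt0// oppr_gt0.
have dz2 : dz (T / 2) < 0.
  have := W_refl 0 (T / 4) coef_half; rewrite /W subr0 z0 dz0 => WE.
  have : weight 0 * (0 * z (T / 2) - 1 * - dz (T / 2)) < 0.
    rewrite WE; have -> : T / 2 - T / 4 = T / 4 by lra.
    rewrite pmulr_rlt0//; have : dz (T / 4) * z (T / 4) < 0 by rewrite pmulr_llt0.
    by lra.
  by rewrite pmulr_rlt0//; lra.
have := W_refl 0 (T / 2) coef_period; rewrite /W subr0 z0 dz0 => WE.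
have : 0 < weight 0 * (0 * z T - 1 * - dz T).
  rewrite WE; have -> : T - T / 2 = T / 2 by lra.
  rewrite pmulr_rgt0//; have : 0 < dz (T / 2) * z (T / 2) by rewrite nmulr_lgt0.
  by lra.
by rewrite pmulr_rgt0//; lra.
Qed.

End EvenSolution.

(* An algebra closed under differentiation, whence the smoothness of [cos r]. *)
Inductive trig_fun : (R -> R) -> Prop :=
| TrigSinR : trig_fun (fun t => sin (r t))
| TrigCosR : trig_fun (fun t => cos (r t))
| TrigSinAl : trig_fun (fun t => sin (al t))
| TrigCosAl : trig_fun (fun t => cos (al t))
| TrigSinTh : trig_fun (fun t => sin (th t))
| TrigCosTh : trig_fun (fun t => cos (th t))
| TrigInvSinR : trig_fun (fun t => (sin (r t))^-1)
| TrigInvSinTh : trig_fun (fun t => (sin (th t))^-1)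
| TrigInvCosTh : trig_fun (fun t => (cos (th t))^-1)
| TrigCst c : trig_fun (fun=> c)
| TrigOpp f : trig_fun f -> trig_fun (fun t => - f t)
| TrigAdd f g : trig_fun f -> trig_fun g -> trig_fun (fun t => f t + g t)
| TrigMul f g : trig_fun f -> trig_fun g -> trig_fun (fun t => f t * g t).

Lemma trig_fun_inv (f df : R -> R) : trig_fun (fun t => (f t)^-1) -> trig_fun df ->
  (forall t, f t != 0) -> (forall t : R, is_derive t 1 f (df t)) ->
  exists2 df', trig_fun df' & forall t : R, is_derive t 1 (fun t => (f t)^-1) (df' t).
Proof.
(* The inverse square is spelled as a product, since the algebra is generated by sums, products and
   opposites. *)
move=> fV tdf f0 fd; exists (fun t => - ((f t)^-1 * (f t)^-1) * df t).
  exact: (TrigMul (TrigOpp (TrigMul fV fV)) tdf).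
move=> t; refine (is_derive_eq (is_deriveVF (f0 t) (fd t)) _).
by rewrite -invfM expr2.
Qed.

Lemma trig_fun_B : trig_fun B.
Proof. by rewrite /B /alpha_rate; repeat constructor. Qed.

Lemma trig_fun_derive f : trig_fun f ->
  exists2 df, trig_fun df & forall t : R, is_derive t 1 f (df t).
Proof.
have tB := trig_fun_B.
have tsa : trig_fun (fun t => sin (al t) / sin (r t)) by repeat constructor.
have dsr : trig_fun (fun t => cos (r t) * cos (al t)) by repeat constructor.
have dst := TrigMul TrigCosTh tsa.
have dct := TrigMul (TrigOpp TrigSinTh) tsa.
elim=> {f}.
- by exists (fun t => cos (r t) * cos (al t)).
- exists (fun t => - sin (r t) * cos (al t)) => //.
  exact: (TrigMul (TrigOpp TrigSinR) TrigCosAl).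
- by exists (fun t => cos (al t) * B t) => //; exact: (TrigMul TrigCosAl tB).
- exists (fun t => - sin (al t) * B t) => //.
  exact: (TrigMul (TrigOpp TrigSinAl) tB).
- by exists (fun t => cos (th t) * (sin (al t) / sin (r t))).
- by exists (fun t => - sin (th t) * (sin (al t) / sin (r t))).
- exact: trig_fun_inv TrigInvSinR dsr sr0 srd.
- exact: trig_fun_inv TrigInvSinTh dst st0 std.
- exact: trig_fun_inv TrigInvCosTh dct ct0 ctd.
- by move=> c; exists (fun=> 0); [exact: TrigCst|move=> t; exact: is_derive_cstF].
- move=> f _ [df tdf fd]; exists (fun t => - df t); first exact: TrigOpp.
  by move=> t; exact: is_deriveNF.
- move=> f g _ [df tdf fd] _ [dg tdg gd]; exists (fun t => df t + dg t); first exact: TrigAdd.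
  by move=> t; exact: is_deriveDF.
- move=> f g tf [df tdf fd] tg [dg tdg gd].
  exists (fun t => f t * dg t + g t * df t).
    exact: (TrigAdd (TrigMul tf tdg) (TrigMul tg tdf)).
  by move=> t; exact: is_deriveMF.
Qed.

Let sep_time m (f : R -> R) (v : 'rV[R]_m) :
  (fun p : pt R m => f p.2) = sep v f (fun=> 1).
Proof. by apply/funext => p; rewrite /sep mulr1. Qed.

Lemma trig_fun_smooth m f : trig_fun f -> smooth (fun p : pt R m => f p.2).
Proof.
move=> tf k; elim: k f tf => [|k IH] f tf; have [df tdf fd] := trig_fun_derive tf.
  move=> p; apply: differentiable_continuous; rewrite (sep_time f 0).
  exact: sep_differentiable fd (fun t => is_derive_cstF 1 t 1).
split=> [p|v].
  by rewrite (sep_time f 0); exact: sep_differentiable fd (fun t => is_derive_cstF 1 t 1).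
have -> : (fun p => 'D_v (fun p : pt R m => f p.2) p) = (fun p => v.2 * df p.2).
  apply/funext => p; rewrite (sep_time f 0).
  have := Dd_sep 0 fd (fun t => is_derive_cstF 1 t 1) v p.
  by rewrite /Dd /sep => ->; rewrite !mulr0 add0r mulr1.
exact: (IH _ (TrigMul (TrigCst v.2) tdf)).
Qed.

(** * Eigenvalues of the hypersurface *)

Hypotheses (r0_itv : 0 < r0 < pi / 2) (r_q : r (- (T / 4)) = r0)
  (r_per : forall t, r (t + T) = r t).

Let ord_n : 'I_n := Ordinal (ltnW n1).
Let e1 : 'rV[R]_n := delta_mx ord0 ord_n.

Let sph_e1 : sph e1.
Proof.
rewrite /sph (bigD1 ord_n)//= mxE !eqxx expr1n big1 ?addr0// => i ie.
by rewrite mxE (negPf ie) andbF expr0n.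
Qed.

Lemma height_eigenvalue : is_eigenvalue n T r th lam.
Proof.
exists (fun p => cos (r p.2)); split; first exact: trig_fun_smooth TrigCosR.
split=> [y z t _ _|]; first by rewrite /= r_per.
split.
  (* At this time [r = r0 < pi / 2], so the height is not zero. *)
  exists e1, e1, (- (T / 4)); do 2!split=> //.
  have /andP[r00 r01] := r0_itv; rewrite /= r_q gt_eqF// cos_gt0_pihalf//.
  by rewrite r01 (lt_trans _ r00)// oppr_lt0 divr_gt0// pi_gt0.
move=> y z t _ _; rewrite (sep_time (fun t => cos (r t)) e1).
have one_d (s : R) : is_derive s 1 (fun=> 1 : R) 0 by exact: is_derive_cstF.
have zero_d (s : R) : is_derive s 1 (fun=> 0 : R) 0 by exact: is_derive_cstF.
have E := warped_lap_sep crd is_derive2_cos_r one_d zero_d a (Ew r th) (Gw r th)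
  (y, z, t) sph_e1.
rewrite [lapX _ _ _ _]E /sep /ddcr /= !mulr0 subr0 mulr0 mul0r.
by ring.
Qed.

Hypothesis th_per : forall t, th (t + T) = th t.

Lemma no_small_eigenvalue (mu : R) : 0 < mu -> mu < lam -> ~ is_eigenvalue n T r th mu.
Proof.
move=> mu0 mul [F [Fs [FT [[y0 [z0 [t0 [y01 [z01 /eqP Fn0]]]]] FE]]]]; apply: Fn0.
have F2 := smooth_twice_differentiable Fs.
have Eu t : Ew r th t = uy t ^+ 2 by rewrite /Ew /uy; ring.
have Gu t : Gw r th t = uz t ^+ 2 by rewrite /Gw /uz; ring.
have E0 t : 0 < Ew r th t by rewrite Eu exprn_gt0// uy_gt0.
have G0 t : 0 < Gw r th t by rewrite Gu exprn_gt0// uz_gt0.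
have uyT t : uy (t + T) = uy t by rewrite /uy r_per th_per.
have uzT t : uz (t + T) = uz t by rewrite /uz r_per th_per.
have uyE t : dduy t + a t * duy t + lam * uy t = N / uy t by rewrite /dduy; ring.
have uzE t : dduz t + a t * duz t + lam * uz t = N / uz t by rewrite /dduz; ring.
have yle := y_independent n1 T0 mul uy_gt0 Eu G0 uyT is_derive_uy is_derive2_uy uyE F2 FT FE.
(* Exchanging the spheres turns [F] into an eigenfunction for the metric with [E] and [G]
   interchanged, to which [y_independent] applies with [uz] as profile. *)
have Fs2 := twice_differentiable_yz_swap F2.
have FsT y z t : sph y -> sph z -> F (yz_swap (y, z, t + T)) = F (yz_swap (y, z, t)).
  by move=> y1 z1; exact: FT.
have FsE y z t : sph y -> sph z -> - warped_lap a (Gw r th) (Ew r th)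
    (fun q => F (yz_swap q)) (y, z, t) = mu * F (yz_swap (y, z, t)).
  by move=> y1 z1; rewrite warped_lap_swap; exact: FE.
have zle := y_independent n1 T0 mul uz_gt0 Gu E0 uzT is_derive_uz is_derive2_uz uzE Fs2 FsT FsE.
have Fyz y z y' z' t : sph y -> sph z -> sph y' -> sph z' -> F (y, z, t) = F (y', z', t).
  move=> y1 z1 y'1 z'1; transitivity (F (y', z, t)).
    by apply/eqP; rewrite eq_le !yle.
  apply/eqP; rewrite eq_le; apply/andP.
  by split; [exact: (zle z z' y' t)|exact: (zle z' z y' t)].
(* As [F] depends on [t] alone on the product of spheres, it is restricted to a line in the
   direction [et]; both spherical Laplacians vanish there and the radial equation remains. *)
pose P t : pt R n := (e1, e1, t).
have PE t : P t = (e1, e1, 0) + t *: et R n.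
  transitivity ((e1 + t *: 0, e1 + t *: 0, 0 + t * 1) : pt R n); last by [].
  by rewrite scaler0 addr0 add0r mulr1.
have Pd (t : R) : is_derive t 1 P (et R n).
  have -> : P = (fun s => (e1, e1, 0) + s *: et R n) by apply/funext => s; exact: PE.
  have cd : is_derive t 1 (fun=> ((e1, e1, 0) : pt R n)) 0 by exact: is_derive_cst.
  have := is_derive_scalel (et R n) (is_derive_idF t); rewrite scale1r => sd.
  by have := is_deriveD cd sd; rewrite add0r.
have [Fd Fd2] := F2.
have fd (t : R) : is_derive t 1 (fun s => F (P s)) (Dd (et R n) F (P t)).
  exact: is_derive_curve (Fd _) (Pd t).
have fd2 (t : R) : is_derive t 1 (fun s => Dd (et R n) F (P s))
    (Dd (et R n) (Dd (et R n) F) (P t)).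
  exact: is_derive_curve (Fd2 (et R n) _) (Pd t).
rewrite (Fyz y0 z0 e1 e1)//.
apply: (radial_eq0 mu0 mul fd fd2) => t; last exact: FT.
have ly : lapSy F (P t) = 0.
  by apply: lapSy_eq0 => // y y1; apply: Fyz.
have lz : lapSz F (P t) = 0.
  rewrite lapSz_swap; apply: lapSy_eq0 => // y y1.
  exact: (Fyz e1 y e1 e1 t).
have := FE e1 e1 t sph_e1 sph_e1.
rewrite [lapX _ _ _ _]/(warped_lap a (Ew r th) (Gw r th) F (P t)) /warped_lap ly lz !mul0r !addr0.
by move=> H; rewrite -H; exact: subrr.
Qed.

End CarlottoSchulz.

Theorem mainTheorem2 (R : realType) (n : nat) (hn : (1 < n)%N)
  (r th al : R -> R) (T r0 th0 : R)
  (hT : 0 < T) (hr0 : 0 < r0 < pi / 2) (hth0 : 0 < th0 < pi / 4)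
  (hr' : forall t : R, is_derive t (1:R) r (cos (al t)))
  (hth' : forall t : R, is_derive t (1:R) th (sin (al t) / sin (r t)))
  (hal' : forall t : R, is_derive t (1:R) al
     ((2 * n - 2)%:R / sin (r t) * cos (al t) * (cos (2 * th t) / sin (2 * th t))
      - (2 * n - 1)%:R * (cos (r t) / sin (r t)) * sin (al t)))
  (hinit : [/\ r 0 = pi / 2, al 0 = 0 & th 0 = th0])
  (hquarter : [/\ th (- (T / 4)) = pi / 4, r (- (T / 4)) = r0 & al (- (T / 4)) = - (pi / 2)])
  (hper : forall t, [/\ r (t + T) = r t, th (t + T) = th t & al (t + T) = al t + 2 * pi])
  (hsym_th : forall t, th (- t) = th t /\ th (T / 2 - t) = pi / 2 - th t)
  (hsym_r : forall t, r (- t) = pi - r t /\ r (T / 2 - t) = r t)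
  (hsym_al : forall t, al (- t) = - al t /\ al (T / 2 - t) = pi - al t)
  (hthmono : forall s t, 0 <= s -> s < t -> t <= T / 2 -> th s < th t)
  (hrmono : forall s t, - (T / 4) <= s -> s < t -> t <= T / 4 -> r s < r t)
  (halmono : forall s t, s < t -> al s < al t)
  (hbounds : forall t, (0 < th t < pi / 2) /\ (0 < r t < pi))
  (z1 dz1 : R -> R)
  (hz1 : forall t : R, is_derive t (1:R) z1 (dz1 t))
  (hdz1 : forall t : R, derivable dz1 t (1:R))
  (hode : forall t, derive1 dz1 t + coefEG n r th t * dz1 t + (2 * n - 1)%:R * z1 t = 0)
  (hz10 : z1 0 = 1) (hdz10 : dz1 0 = 0) :
  first_nonzero_eigenvalue n T r th (2 * n - 1)%:R <-> 0 < dz1 T.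
Proof.
have [r_0 al_0 th_0] := hinit; have [th_q r_q al_q] := hquarter.
have r_per t : r (t + T) = r t by case: (hper t).
have th_per t : th (t + T) = th t by case: (hper t).
have dz1d (t : R) : is_derive t (1 : R) dz1 (derive1 dz1 t).
  by rewrite derive1E; apply: DeriveDef => //; exact: hdz1.
split=> [_|_].
  exact: (even_solution_derive_gt0 hn hr' hth' hal' r_0 al_0 th_q al_q hsym_th
    hsym_r hsym_al hthmono hrmono hbounds hT hz1 dz1d hode hz10 hdz10).
split; first by rewrite ltr0n subn_gt0 (leq_trans hn) // leq_pmull.
split; first exact: (height_eigenvalue hn hr' hth' hal' hbounds hr0 r_q r_per).
move=> mu mu0 mul.
exact: (no_small_eigenvalue hn hr' hth' hal' r_0 th_q hsym_th hsym_r hsym_al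
  hthmono hrmono hbounds hT r_per th_per mu0 mul).
Qed.
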